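(* Let $\Gamma$ be a countable discrete group with Kazhdan's property (T) which is infinitely presented (i.e. not finitely presentable). If $\Gamma$ is weakly ucp-stable, then there exists a non-hyperlinear group.
   Context: For a finite-dimensional Hilbert space $\mathcal{H}$ of dimension $d$ and $x \in B(\mathcal{H})$, $\tau_d(x) = \frac1d \mathrm{Tr}(x)$ and $\|x\|_{2,\tau_d} = \tau_d(x^*x)^{1/2}$ (normalized Hilbert–Schmidt norm). $U(\mathcal{H})$ is the unitary group of $\mathcal{H}$ and $U(d) = U(\mathbb{C}^d)$. Hyperlinear: a group $G$ is hyperlinear if for every $\epsilon>0$ and every finite subset $F \subset G$ there exist $d \in \mathbb{N}$ and a map $\varphi: F \to U(d)$ such that $\|\varphi(g)\varphi(h) - \varphi(gh)\|_{2,\tau_d} < \epsilon$ for all $g,h \in F$ with $gh \in F$, and $\|\varphi(g) - 1\|_{2,\tau_d} > \sqrt{2} - \epsilon$ for all $g \in F \setminus \{1_G\}$. Hyperlinear approximation of a countable group $\Gamma$: a sequence of maps $\varphi_n : \Gamma \to U(\mathcal{H}_n)$, with $\mathcal{H}_n$ finite-dimensional Hilbert spaces of dimension $d_n$, such that $\lim_n \|\varphi_n(g)\varphi_n(h) - \varphi_n(gh)\|_{2,\tau_{d_n}} = 0$ for all $g,h \in \Gamma$ and $\liminf_n \|\varphi_n(g) - 1\|_{2,\tau_{d_n}} \ge \sqrt{2}$ for every $1 \ne g \in \Gamma$. Weakly ucp-stable: a countable group $\Gamma$ is weakly ucp-stable if for every hyperlinear approximation $\varphi_n : \Gamma \to U(\mathcal{H}_n)$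 there exist (possibly infinite-dimensional) Hilbert spaces $\widehat{\mathcal{H}}_n \supseteq \mathcal{H}_n$ and homomorphisms $\pi_n : \Gamma \to U(\widehat{\mathcal{H}}_n)$ such that $\|\varphi_n(g) - P_n\pi_n(g)P_n\|_{2,\tau_{\dim \mathcal{H}_n}} \to 0$ as $n \to \infty$ for all $g \in \Gamma$, where $P_n$ is the orthogonal projection of $\widehat{\mathcal{H}}_n$ onto $\mathcal{H}_n$ (so $P_n\pi_n(g)P_n$ is regarded as an operator on $\mathcal{H}_n$). *)

(* Defs.v *)
From HB Require Import structures.
From mathcomp Require Import all_boot all_order all_algebra.
From mathcomp Require Import complex.
From mathcomp Require Import all_classical all_reals all_analysis.

Set Implicit Arguments.
Unset Strict Implicit.
Unset Printing Implicit Defensive.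

Import Order.TTheory GRing.Theory Num.Theory.
Import numFieldNormedType.Exports.

Local Open Scope classical_set_scope.
Local Open Scope ring_scope.
Local Open Scope complex_scope.
Local Open Scope sesquilinear_scope.

(* Finite presentability.  A letter (i, false) stands for the i-th generator,
   (i, true) for its formal inverse. *)

Definition word (n : nat) : Type := seq ('I_n * bool).

Definition letter_val (G : groupType) (n : nat) (s : 'I_n -> G)
    (l : 'I_n * bool) : G :=
  if l.2 then ((s l.1)^-1)%g else s l.1.

Definition word_val (G : groupType) (n : nat) (s : 'I_n -> G) (w : word n) : G :=
  (\prod_(l <- w) letter_val s l)%g.

(* The group < x_1, ..., x_n | rels > is the set of words modulo this relation,
   with concatenation as product. *)
Inductive word_eqv (n : nat) (rels : seq (word n)) : word n -> word n -> Prop :=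
| word_eqv_refl u : word_eqv rels u u
| word_eqv_sym u v : word_eqv rels u v -> word_eqv rels v u
| word_eqv_trans u v w :
    word_eqv rels u v -> word_eqv rels v w -> word_eqv rels u w
| word_eqv_cancel u v i b :
    word_eqv rels (u ++ [:: (i, b); (i, ~~ b)] ++ v) (u ++ v)
| word_eqv_relator u r v : r \in rels -> word_eqv rels (u ++ r ++ v) (u ++ v).

(* word_val s induces an isomorphism from < x_1, ..., x_n | rels > onto G. *)
Definition finitely_presentable (G : groupType) : Prop :=
  exists (n : nat) (s : 'I_n -> G) (rels : seq (word n)),
    (forall g : G, exists w : word n, word_val s w = g) /\
    (forall u v : word n, word_val s u = word_val s v <-> word_eqv rels u v).

(* Normalized Hilbert-Schmidt norm on 'M[R[i]]_d. *)

Definition ntrace (R : realType) (d : nat) (A : 'M[R[i]]_d) : R[i] :=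
  d%:R^-1 * \tr A.

(* ntrace (A^* A) is a nonnegative real number; Re turns it into an element
   of R. *)
Definition norm2 (R : realType) (d : nat) (A : 'M[R[i]]_d) : R :=
  Num.sqrt (complex.Re (ntrace (A ^t* *m A))).

Definition hyperlinear (R : realType) (G : groupType) : Prop :=
  forall (e : R) (F : seq G), 0 < e ->
    exists (d : nat) (phi : G -> 'M[R[i]]_d),
    [/\ (0 < d)%N,
        (forall g, g \in F -> phi g \is unitarymx),
        (forall g h, g \in F -> h \in F -> (g * h)%g \in F ->
           norm2 (phi g *m phi h - phi (g * h)%g) < e) &
        (forall g, g \in F -> g != 1%g ->
           Num.sqrt 2 - e < norm2 (phi g - 1%:M))].

(* Complex Hilbert spaces; the inner product is linear in its first
   argument. *)

Definition dot_norm (R : realType) (V : lmodType R[i])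
    (dot : {dot V for (@Num.conj R[i])}) (x : V) : R :=
  Num.sqrt (complex.Re (dot x x)).

Record hilbert (R : realType) := Hilbert {
  hcarrier :> lmodType R[i];
  hdot : {dot hcarrier for (@Num.conj R[i])};
  hcomplete : forall u : nat -> hcarrier,
    (forall e : R, 0 < e -> exists N : nat, forall m n : nat,
       (N <= m)%N -> (N <= n)%N -> dot_norm hdot (u m - u n) < e) ->
    exists l : hcarrier, (fun n => dot_norm hdot (u n - l)) @ \oo --> (0 : R)
}.

Definition hnorm (R : realType) (H : hilbert R) (x : H) : R :=
  dot_norm (hdot H) x.

Definition unitary_op (R : realType) (H : hilbert R)
    (u : {linear H -> H}) : Prop :=
  (forall x y : H, hdot H (u x) (u y) = hdot H x y) /\
  (forall y : H, exists x : H, u x = y).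

Definition unitary_rep (R : realType) (G : groupType) (H : hilbert R)
    (pi : G -> {linear H -> H}) : Prop :=
  (forall g : G, unitary_op (pi g)) /\
  (forall (g h : G) (x : H), pi (g * h)%g x = pi g (pi h x)).

(* For a discrete group, Kazhdan sets Q are finite subsets. *)
Definition property_T (R : realType) (G : groupType) : Prop :=
  exists (Q : seq G) (e : R), 0 < e /\
    forall (H : hilbert R) (pi : G -> {linear H -> H}), unitary_rep pi ->
      (exists2 x : H, x != 0 &
         forall g, g \in Q -> hnorm (pi g x - x) < e * hnorm x) ->
      exists2 y : H, y != 0 & forall g : G, pi g y = y.

(* Nonzero finite-dimensional Hilbert spaces.  The orthonormal basis fdbasis
   witnesses the dimension and serves to compute traces, which do not depend
   on it. *)
Record fdhilbert (R : realType) := FDHilbert {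
  fdspace :> hilbert R;
  fddim : nat;
  fddim_gt0 : (0 < fddim)%N;
  fdbasis : 'I_fddim -> fdspace;
  fdbasis_orthonormal : forall i j,
    hdot fdspace (fdbasis i) (fdbasis j) = (i == j)%:R;
  fdbasis_span : forall x : fdspace,
    exists c : 'I_fddim -> R[i], x = \sum_i c i *: fdbasis i
}.

Definition op_mx (R : realType) (H : fdhilbert R) (T : H -> H)
    : 'M[R[i]]_(fddim H) :=
  \matrix_(i, j) hdot H (T (fdbasis (f := H) j)) (fdbasis i).

Definition op_norm2 (R : realType) (H : fdhilbert R) (T : H -> H) : R :=
  norm2 (op_mx T).

Definition hyperlinear_approximation (R : realType) (G : groupType)
    (H : nat -> fdhilbert R)
    (phi : forall n, G -> {linear H n -> H n}) : Prop :=
  [/\ (forall n g, unitary_op (phi n g)),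
      (forall g h : G,
         (fun n => op_norm2
            (fun x : H n => phi n g (phi n h x) - phi n (g * h)%g x))
           @ \oo --> (0 : R)) &
      (forall g : G, g != 1%g ->
         ((Num.sqrt 2 : R)%:E <=
          limn_einf (fun n => (op_norm2 (fun x : H n => phi n g x - x))%:E))%E)].

(* Inclusions of Hilbert spaces H <= K are given by linear isometries J. *)
Definition isometric_embedding (R : realType) (H K : hilbert R)
    (J : {linear H -> K}) : Prop :=
  forall x y : H, hdot K (J x) (J y) = hdot H x y.

(* P is the orthogonal projection of K onto J(H), read as a map into H. *)
Definition orthogonal_projection (R : realType) (H K : hilbert R)
    (J : {linear H -> K}) (P : {linear K -> H}) : Prop :=
  forall (y : K) (x : H), hdot K (y - J (P y)) (J x) = 0.

Definition weakly_ucp_stable (R : realType) (G : groupType) : Prop :=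
  forall (H : nat -> fdhilbert R) (phi : forall n, G -> {linear H n -> H n}),
    hyperlinear_approximation phi ->
    exists (K : nat -> hilbert R)
           (J : forall n, {linear H n -> K n})
           (P : forall n, {linear K n -> H n})
           (pi : forall n, G -> {linear K n -> K n}),
      [/\ (forall n, isometric_embedding (J n)),
          (forall n, orthogonal_projection (J n) (P n)),
          (forall n, unitary_rep (pi n)) &
          (forall g : G,
             (fun n => op_norm2
                (fun x : H n => phi n g x - P n (pi n g (J n x))))
               @ \oo --> (0 : R))].

(* Main.v *)
(* Let [G_m] be the group presented by the generators of [Gamma] and its first
   [m] relators; as [Gamma] is not finitely presentable, some word [k_m] is trivial
   in [Gamma] but not in [G_m]. If all groups were hyperlinear, the [G_m] would
   have almost representations by unitary matrices [Psi_m] moving [k_m] far from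
   the identity, and these would form a hyperlinear approximation of [Gamma]. By
   stability it is, in norm 2, close to the compressions of representations [pi_m]
   of [Gamma] along isometries [J_m] from [C^d] to [K_m]. In the Hilbert-Schmidt
   operators from [C^d] to [K_m], on which words act exactly by
   [T |-> pi_m(w) T Psi_m(w)^*], the vector [J_m] is then almost fixed by the
   generators, but [k_m] moves it by [|Psi_m(k_m) - 1|], about [sqrt 2].

   This contradicts a form of Shalom's theorem that (T) passes to the [G_m] for
   large [m], with uniform constants. Iterating [xi |-> xi - theta lap xi] from
   [J_m] would converge to a vector fixed by the generators, close to [J_m], if
   [|lap xi|^2 >= kappa energy xi] at every step. Were this to fail for infinitely
   many [m], at vectors [xi_m], the normalized displacements
   [|w xi_m - xi_m|^2 / energy xi_m] would have an ultralimit [psi] on [Gamma] of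
   conditionally negative type. Schoenberg's functions [exp (- t psi)] are positive
   definite, (T) bounds the gap of the representations they define, and [t -> 0]
   gives a lower bound on the gap of [psi]. *)
Require Import Defs.
From HB Require Import structures.
From mathcomp Require Import all_boot all_order all_algebra.
From mathcomp Require Import complex.
From mathcomp Require Import all_classical all_reals all_analysis.
From mathcomp Require Import ring lra zify.

Set Implicit Arguments.
Unset Strict Implicit.
Unset Printing Implicit Defensive.

Import Order.TTheory GRing.Theory Num.Theory.
Import numFieldNormedType.Exports.

Local Open Scope classical_set_scope.
Local Open Scope ring_scope.
Local Open Scope complex_scope.
Local Open Scope sesquilinear_scope.

(** * Semi-inner products and Hilbert space completion *)

(** The order of the choices matters. [k_m] depends only on the first [m] relators, so the matrices
    are chosen after it, with a tolerance that takes the length of [k_m] into account. Their defect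
    on relators is then negligible against [(10 (|k_m| + 1))^-1], the displacement scale at which
    the walk stops; this is what lets relators become trivial after division by the energy, so that
    the ultralimit descends to [Gamma].

    The same division requires the defect of a relator to be small at all translates [v xi_m] at
    once. At [J_m] this holds because [pi_m] kills relators and the norm 2 is unitarily invariant;
    convexity then carries it along the walk.

    Closeness to a compression, rather than to a representation, suffices: the inner product of
    [pi(g) J Psi(g)^*] with [J] is the real part of the normalized trace of [Psi(g)^* B], where [B]
    is the compression of [pi(g)], so the vector [J] only sees [B]. *)

Lemma quadratic_ge0_disc (R : realFieldType) (a b d : R) :
  (forall t, 0 <= a + t * b *+ 2 + t ^+ 2 * d) -> b ^+ 2 <= a * d.
Proof.
move=> H.
have d_ge0 : 0 <= d.
  rewrite leNgt; apply/negP => d0.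
  have a0 : 0 <= a by have := H 0; rewrite mul0r mul0rn expr0n mul0r !addr0.
  (* The values at [t] and [- t] add up to twice [a + t ^+ 2 * d], which is negative for this [t]
     when [d < 0]. *)
  have H1 := H ((a + 1) / - d + 1); have H2 := H (- ((a + 1) / - d + 1)).
  have k0 : 0 <= (a + 1) / - d by apply: divr_ge0; lra.
  have kd : (a + 1) / - d * d = - (a + 1).
    by rewrite invrN mulrN mulNr divfK // lt_eqF.
  move: H1 H2 k0 kd; set k := (a + 1) / - d => H1 H2 k0 kd.
  nra.
have [d0|d0] := eqVneq d 0; last first.
  have dp : 0 < d by rewrite lt_def d0.
  have /(mulr_ge0 (ltW dp)) := H (- b / d).
  have -> : d * (a + - b / d * b *+ 2 + (- b / d) ^+ 2 * d) = a * d - b ^+ 2.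
    by field.
  by rewrite subr_ge0.
rewrite d0 mulr0; have [->|b0] := eqVneq b 0; first by rewrite expr0n.
(* With [d = 0] the form is affine in [t], and it takes the value -1 here. *)
have := H (- (a + 1) / b / 2); rewrite d0 mulr0 addr0.
have -> : a + - (a + 1) / b / 2 * b *+ 2 = - 1 by field.
by rewrite oppr_ge0 ler10.
Qed.

(* Only the bilinearity equations are required, so that formal combinations
   [seq (R * T)] qualify without being quotiented to a module. *)
Record semi_ip (R : realType) := SemiIp {
  sip_car :> Type;
  sip0 : sip_car;
  sip_add : sip_car -> sip_car -> sip_car;
  sip_scale : R -> sip_car -> sip_car;
  ip : sip_car -> sip_car -> R;
  ipDl : forall x y z, ip (sip_add x y) z = ip x z + ip y z;
  ipZl : forall a x z, ip (sip_scale a x) z = a * ip x z;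
  ipC : forall x y, ip x y = ip y x;
  ip_ge0 : forall x, 0 <= ip x x
}.

Arguments sip0 {R s}.

Section SemiIpTheory.
Context {R : realType} {X : semi_ip R}.
Implicit Types x y z : X.

Definition sip_sub x y := sip_add x (sip_scale (- 1) y).
Definition ipnorm x : R := Num.sqrt (ip x x).

Lemma ipDr x y z : ip x (sip_add y z) = ip x y + ip x z.
Proof. by rewrite ipC ipDl !(ipC _ x). Qed.
Lemma ipZr a x z : ip x (sip_scale a z) = a * ip x z.
Proof. by rewrite ipC ipZl ipC. Qed.
Lemma ipBl x y z : ip (sip_sub x y) z = ip x z - ip y z.
Proof. by rewrite ipDl ipZl mulN1r. Qed.
Lemma ipBr x y z : ip x (sip_sub y z) = ip x y - ip x z.
Proof. by rewrite ipDr ipZr mulN1r. Qed.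

Lemma cauchy_schwarz x y : ip x y ^+ 2 <= ip x x * ip y y.
Proof.
apply: quadratic_ge0_disc => t.
have := ip_ge0 (sip_add x (sip_scale t y)).
rewrite !(ipDl, ipDr, ipZl, ipZr) (ipC y x) => /le_trans; apply.
by rewrite le_eqVlt; apply/orP; left; apply/eqP; ring.
Qed.

Lemma ipnorm_ge0 x : 0 <= ipnorm x. Proof. exact: sqrtr_ge0. Qed.
Lemma ipnorm_sqr x : ipnorm x ^+ 2 = ip x x.
Proof. by rewrite sqr_sqrtr ?ip_ge0. Qed.

Lemma cauchy_schwarz_norm x y : `|ip x y| <= ipnorm x * ipnorm y.
Proof.
rewrite -(@ler_pXn2r _ 2) ?nnegrE ?mulr_ge0 ?ipnorm_ge0 ?normr_ge0 //.
by rewrite exprMn !ipnorm_sqr real_normK ?num_real ?cauchy_schwarz.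
Qed.

Lemma ip_le_norm x y : ip x y <= ipnorm x * ipnorm y.
Proof. exact: le_trans (ler_norm _) (cauchy_schwarz_norm x y). Qed.

Lemma ipnormD x y : ipnorm (sip_add x y) <= ipnorm x + ipnorm y.
Proof.
rewrite -(@ler_pXn2r _ 2) ?nnegrE ?addr_ge0 ?ipnorm_ge0 //.
rewrite ipnorm_sqr !(ipDl, ipDr) (ipC y x) sqrrD !ipnorm_sqr.
have := ip_le_norm x y; lra.
Qed.

Lemma ipnormZ a x : ipnorm (sip_scale a x) = `|a| * ipnorm x.
Proof.
by rewrite /ipnorm ipZl ipZr mulrA -expr2 sqrtrM ?sqr_ge0 // sqrtr_sqr.
Qed.

Lemma ipnormBC x y : ipnorm (sip_sub x y) = ipnorm (sip_sub y x).
Proof. by congr Num.sqrt; rewrite !(ipBl, ipBr) (ipC x y); ring. Qed.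

Lemma ipnormB_trans y x z :
  ipnorm (sip_sub x z) <= ipnorm (sip_sub x y) + ipnorm (sip_sub y z).
Proof.
apply: le_trans (ipnormD _ _); rewrite le_eqVlt; apply/orP; left; apply/eqP.
by congr Num.sqrt; rewrite !(ipDl, ipDr, ipBl, ipBr); ring.
Qed.

Lemma ipnorm_le_sub x y : ipnorm x <= ipnorm y + ipnorm (sip_sub x y).
Proof.
apply: le_trans (ipnormD _ _); rewrite le_eqVlt; apply/orP; left; apply/eqP.
by congr Num.sqrt; rewrite !(ipDl, ipDr, ipBl, ipBr) (ipC y x); ring.
Qed.

End SemiIpTheory.

Lemma cvgn_epsP (R : realType) (u : nat -> R) (l : R) :
  u @ \oo --> l <-> forall e, 0 < e ->
    exists N, forall n, (N <= n)%N -> `|u n - l| < e.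
Proof.
split=> [/cvgrPdist_lt ul e e0|H].
  by have [N _ HN] := ul e e0; exists N => n /HN /=; rewrite distrC.
apply/cvgrPdist_lt => e /H[N HN]; exists N => // n /= /HN.
by rewrite distrC.
Qed.

Lemma cauchyn_cvg (R : realType) (u : nat -> R) :
  (forall e, 0 < e -> exists N, forall m n,
     (N <= m)%N -> (N <= n)%N -> `|u m - u n| < e) ->
  exists l : R, u @ \oo --> l.
Proof.
move=> H; exists (lim (u @ \oo)).
suff : cvg (u @ \oo) by [].
apply/cauchy_cvgP/cauchy_exP => e /H[N HN]; exists (u N).
by exists N => // n /= Nn; apply: HN.
Qed.

Lemma cvgr_unique (R : realType) (I : Type) (F : set_system I)
  {FF : ProperFilter F} (u : I -> R) (l l' : R) :
  u @ F --> l -> u @ F --> l' -> l = l'.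
Proof. by move=> ul ul'; apply: (cvg_unique _ ul ul'). Qed.

Section Completion.
Context {R : realType} (X : semi_ip R).
Implicit Types u v : nat -> X.

Definition sip_cauchy u := forall e : R, 0 < e -> exists N, forall m n,
  (N <= m)%N -> (N <= n)%N -> ipnorm (sip_sub (u m) (u n)) < e.

Definition represents u (F : X -> R) :=
  sip_cauchy u /\ forall x, (fun n => ip (u n) x) @ \oo --> F x.

Lemma sip_cauchy_bounded u : sip_cauchy u ->
  exists M N, 0 < M /\ forall n, (N <= n)%N -> ipnorm (u n) <= M.
Proof.
move=> /(_ 1 ltr01)[N HN]; exists (ipnorm (u N) + 1), N.
split=> [|n Nn]; first by rewrite ltr_wpDl ?ipnorm_ge0.
by apply: le_trans (ipnorm_le_sub _ (u N)) _; rewrite lerD2l ltW ?HN.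
Qed.

Lemma sip_cauchyD a u v : sip_cauchy u -> sip_cauchy v ->
  sip_cauchy (fun n => sip_add (u n) (sip_scale a (v n))).
Proof.
move=> uC vC e e0.
have e1 : 0 < e / 2 by lra.
have e2 : 0 < e / 2 / (`|a| + 1) by rewrite divr_gt0 // ltr_wpDl.
have [M HM] := uC _ e1; have [N HN] := vC _ e2.
exists (maxn M N) => m n; rewrite !geq_max => /andP[Mm Nm] /andP[Mn Nn].
have -> : ipnorm (sip_sub (sip_add (u m) (sip_scale a (v m)))
    (sip_add (u n) (sip_scale a (v n)))) =
  ipnorm (sip_add (sip_sub (u m) (u n)) (sip_scale a (sip_sub (v m) (v n)))).
  by congr Num.sqrt; rewrite !(ipDl, ipDr, ipBl, ipBr, ipZl, ipZr); ring.
apply: le_lt_trans (ipnormD _ _) _; rewrite ipnormZ.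
have := HM _ _ Mm Mn; have := HN _ _ Nm Nn.
rewrite ltr_pdivlMr ?ltr_wpDl //.
have := ipnorm_ge0 (sip_sub (v m) (v n)).
move: (ipnorm _) (ipnorm _) `|a| => p q b; nra.
Qed.

Lemma sip_cauchyB u v : sip_cauchy u -> sip_cauchy v ->
  sip_cauchy (fun n => sip_sub (u n) (v n)).
Proof. exact: sip_cauchyD. Qed.

Lemma ip_cauchy_cvg u v : sip_cauchy u -> sip_cauchy v ->
  exists l : R, (fun n => ip (u n) (v n)) @ \oo --> l.
Proof.
move=> uC vC; apply: cauchyn_cvg => e e0.
have [M1 [N1 [M1_gt0 B1]]] := sip_cauchy_bounded uC.
have [M2 [N2 [M2_gt0 B2]]] := sip_cauchy_bounded vC.
have e1 : 0 < e / 2 / M2 by rewrite !divr_gt0.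
have e2 : 0 < e / 2 / M1 by rewrite !divr_gt0.
have [N3 H3] := uC _ e1; have [N4 H4] := vC _ e2.
exists (maxn (maxn N1 N2) (maxn N3 N4)) => m n; rewrite !geq_max.
move=> /andP[/andP[N1m N2m] /andP[N3m N4m]].
move=> /andP[/andP[N1n N2n] /andP[N3n N4n]].
have -> : ip (u m) (v m) - ip (u n) (v n) =
  ip (sip_sub (u m) (u n)) (v m) + ip (u n) (sip_sub (v m) (v n)).
  by rewrite ipBl ipBr; ring.
apply: le_lt_trans (ler_normD _ _) _.
have := cauchy_schwarz_norm (sip_sub (u m) (u n)) (v m).
have := cauchy_schwarz_norm (u n) (sip_sub (v m) (v n)).
have := H3 _ _ N3m N3n; have := H4 _ _ N4m N4n.
rewrite !ltr_pdivlMr //.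
have := B1 _ N1n; have := B2 _ N2m.
have := ipnorm_ge0 (u n); have := ipnorm_ge0 (v m).
have := ipnorm_ge0 (sip_sub (u m) (u n)).
have := ipnorm_ge0 (sip_sub (v m) (v n)).
move: (ipnorm _) (ipnorm _) (ipnorm _) (ipnorm _) => p q r s.
move=> s0 r0 q0 p0 qM pM h1 h2 h3 h4.
have : p * s <= M1 * s by rewrite ler_wpM2r.
have : r * q <= r * M2 by rewrite ler_wpM2l.
lra.
Qed.

(** Write <u_n, u_n> = <u_n, u_N> + <u_n, u_n - u_N>: the first term is small by weak convergence,
    the second by the Cauchy property. This makes products in the completion independent of the
    representing sequences. *)
Lemma weak_null_cauchy u : sip_cauchy u ->
  (forall x, (fun n => ip (u n) x) @ \oo --> (0 : R)) ->
  (fun n => ipnorm (u n)) @ \oo --> (0 : R).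
Proof.
move=> uC u0; apply/cvgn_epsP => e e0.
have [M [N1 [M_gt0 B]]] := sip_cauchy_bounded uC.
have e1 : 0 < e ^+ 2 / 2 / M by rewrite !divr_gt0 ?exprn_gt0.
have e2 : 0 < e ^+ 2 / 2 by rewrite !divr_gt0 ?exprn_gt0.
have [N2 H2] := uC _ e1.
have /cvgn_epsP /(_ _ e2)[N3 H3] := u0 (u N2).
exists (maxn N1 (maxn N2 N3)) => n; rewrite !geq_max => /and3P[N1n N2n N3n].
rewrite subr0 ger0_norm ?ipnorm_ge0 // -(@ltr_pXn2r _ 2) ?nnegrE ?ipnorm_ge0 ?ltW //.
rewrite ipnorm_sqr.
have -> : ip (u n) (u n) = ip (u n) (u N2) + ip (u n) (sip_sub (u n) (u N2)).
  by rewrite ipBr; ring.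
have := ip_le_norm (u n) (sip_sub (u n) (u N2)).
have := H3 _ N3n; rewrite subr0 => /(le_lt_trans (ler_norm _)).
have := H2 _ _ N2n (leqnn _); rewrite ltr_pdivlMr //.
have := B _ N1n; have := ipnorm_ge0 (sip_sub (u n) (u N2)).
move: (ipnorm _) (ipnorm _) => q p p0 qM pM h1 h2.
have : q * p <= M * p by rewrite ler_wpM2r.
lra.
Qed.

Lemma cauchy_ip_null u v : sip_cauchy u -> sip_cauchy v ->
  (forall x, (fun n => ip (u n) x) @ \oo --> (0 : R)) ->
  (fun n => ip (u n) (v n)) @ \oo --> (0 : R).
Proof.
move=> uC vC u0; apply/cvgn_epsP => e e0.
have [M [N1 [M_gt0 B]]] := sip_cauchy_bounded vC.
have e1 : 0 < e / M by rewrite divr_gt0.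
have /cvgn_epsP /(_ _ e1)[N2 H2] := weak_null_cauchy uC u0.
exists (maxn N1 N2) => n; rewrite geq_max => /andP[N1n N2n].
rewrite subr0; apply: le_lt_trans (cauchy_schwarz_norm _ _) _.
have := H2 _ N2n; rewrite subr0 ger0_norm ?ipnorm_ge0 // ltr_pdivlMr //.
apply: le_lt_trans; rewrite ler_wpM2l ?ipnorm_ge0 //; exact: B.
Qed.

Lemma represents_ip_eq u u' v (F : X -> R) : represents u F -> represents u' F ->
  sip_cauchy v -> (fun n => ip (u n) (v n) - ip (u' n) (v n)) @ \oo --> (0 : R).
Proof.
move=> [uC uF] [u'C u'F] vC.
under eq_fun do rewrite -ipBl.
apply: cauchy_ip_null => //; first exact: sip_cauchyB.
move=> x; under eq_fun do rewrite ipBl.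
by rewrite -(subrr (F x)); apply: cvgB.
Qed.

(* A point of the completion is represented by the functional [ip _ x] it
   induces on [X], so that no quotient is needed. *)
Definition in_completion : {pred X -> R} :=
  fun F => `[< exists u, represents u F >].

Lemma representsD a u v (F G : X -> R) : represents u F -> represents v G ->
  represents (fun n => sip_add (u n) (sip_scale a (v n))) (F + a *: G).
Proof.
move=> [uC uF] [vC vG]; split; first exact: sip_cauchyD.
move=> x; under eq_fun do rewrite ipDl ipZl.
by apply: cvgD (uF x) _; apply: cvgM (vG x); apply: cvg_cst.
Qed.

Lemma represents_cst x : represents (fun=> x) (ip x).
Proof.
split=> [e e0|y]; last exact: cvg_cst.
exists 0 => m n _ _; rewrite /ipnorm; set a := ip _ _.
suff -> : a = 0 by rewrite sqrtr0.
by rewrite /a !(ipBl, ipBr); ring.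
Qed.

(** No law of [semi_ip] mentions [sip0], so null vectors are obtained by scaling by 0. *)
Lemma represents0 x : represents (fun=> sip_scale 0 x) 0.
Proof.
have [xC xF] := represents_cst (sip_scale 0 x); split=> // y.
by under eq_fun do rewrite ipZl mul0r; apply: cvg_cst.
Qed.

Lemma in_completion_submod : GRing.submod_closed in_completion.
Proof.
split=> [|a F G /asboolP[u uF] /asboolP[v vG]]; apply/asboolP.
  by exists (fun=> sip_scale 0 sip0); apply: represents0.
exists (fun n => sip_add (v n) (sip_scale a (u n))).
by rewrite addrC; apply: representsD.
Qed.

HB.instance Definition _ :=
  GRing.isSubmodClosed.Build R (X -> R) in_completion in_completion_submod.

Record completion := Completion {
  completion_fun :> X -> R;
  completion_funP : completion_fun \in in_completion
}.
HB.instance Definition _ := [isSub for completion_fun].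
HB.instance Definition _ := [Choice of completion by <:].
HB.instance Definition _ := [SubChoice_isSubLmodule of completion by <:].

Implicit Types F G K : completion.

Lemma completion_ex (F : completion) : exists u, represents u F.
Proof. exact/asboolP/(completion_funP F). Qed.

Definition approx (F : completion) : nat -> X := projT1 (cid (completion_ex F)).

Lemma approxP F : represents (approx F) F.
Proof. exact: projT2 (cid (completion_ex F)). Qed.

Definition cdot (F G : completion) : R :=
  lim ((fun n => ip (approx F n) (approx G n)) @ \oo).

Lemma cdotE u v (F G : completion) : represents u F -> represents v G ->
  (fun n => ip (u n) (v n)) @ \oo --> cdot F G.
Proof.
move=> uF vG; have [uC _] := uF; have [vC _] := vG.
have aF := approxP F; have aG := approxP G.
have [l hl] := ip_cauchy_cvg aF.1 aG.1.
rewrite /cdot (cvg_lim _ hl) //.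
have h1 := represents_ip_eq uF aF vC.
have h2 : (fun n => ip (approx F n) (v n) - ip (approx F n) (approx G n)) @ \oo
    --> (0 : R).
  under eq_fun do rewrite ipC (ipC (approx F _)).
  exact: represents_ip_eq vG aG aF.1.
have -> : (fun n => ip (u n) (v n)) = (fun n =>
    (ip (u n) (v n) - ip (approx F n) (v n)) +
    (ip (approx F n) (v n) - ip (approx F n) (approx G n)) +
    ip (approx F n) (approx G n)) by apply/funext => n; ring.
have -> : l = 0 + 0 + l by ring.
by apply: cvgD hl; apply: cvgD.
Qed.

Lemma cdotC F G : cdot F G = cdot G F.
Proof.
apply: (cvgr_unique (cdotE (approxP F) (approxP G))).
under eq_fun do rewrite ipC.
exact: cdotE (approxP G) (approxP F).
Qed.

Lemma cdotPl a F G K : cdot (F + a *: G) K = cdot F K + a * cdot G K.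
Proof.
have FGr := representsD a (approxP F) (approxP G).
apply: (cvgr_unique (@cdotE _ _ (F + a *: G) K FGr (approxP K))).
under eq_fun do rewrite ipDl ipZl.
apply: cvgD (cdotE (approxP F) (approxP K)) _.
by apply: cvgM (cdotE (approxP G) (approxP K)); apply: cvg_cst.
Qed.

Lemma cdotDl F G K : cdot (F + G) K = cdot F K + cdot G K.
Proof. by rewrite -[G]scale1r cdotPl scale1r mul1r. Qed.

Lemma cdot0l F : cdot 0 F = 0.
Proof.
have := cdotDl 0 0 F; rewrite addr0 => /eqP.
by rewrite -subr_eq0 opprD addNKr oppr_eq0 => /eqP.
Qed.

Lemma cdotZl a F G : cdot (a *: F) G = a * cdot F G.
Proof. by rewrite -[a *: F]add0r cdotPl cdot0l add0r. Qed.

Lemma cdot_ge0 F : 0 <= cdot F F.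
Proof.
apply: (cvgr_to_ge (cdotE (approxP F) (approxP F))).
by apply: nearW => n; apply: ip_ge0.
Qed.

Definition completion_ip : semi_ip R :=
  SemiIp (0 : completion) cdotDl cdotZl cdotC cdot_ge0.

Lemma in_completion_ip x : (ip x : X -> R) \in in_completion.
Proof. by apply/asboolP; exists (fun=> x); apply: represents_cst. Qed.

Definition to_completion x : completion := Completion (in_completion_ip x).

Lemma cdot_to_completion x F : cdot (to_completion x) F = F x.
Proof.
have xr : represents (fun=> x) (to_completion x) by apply: represents_cst.
apply: (cvgr_unique (cdotE xr (approxP F))).
under eq_fun do rewrite ipC.
exact: (approxP F).2.
Qed.

(** Evaluation at [x] is the product with [to_completion x], so this is Cauchy-Schwarz. It gives the
    definiteness of [cdot] and the boundedness of invariant functionals. *)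
Lemma completion_eval_bound F x : F x ^+ 2 <= cdot F F * ip x x.
Proof.
have := @cauchy_schwarz _ completion_ip F (to_completion x).
by rewrite /= cdotC !cdot_to_completion.
Qed.

Lemma cdot_eq0 F : cdot F F = 0 -> F = 0.
Proof.
move=> F0; apply: val_inj; apply/funext => x /=.
have := completion_eval_bound F x; rewrite F0 mul0r => h.
by apply/eqP; rewrite -sqrf_eq0 eq_le h sqr_ge0.
Qed.

Lemma represents_dist u (F : completion) : represents u F -> forall e : R, 0 < e ->
  exists N, forall n, (N <= n)%N ->
    @ipnorm _ completion_ip (F - to_completion (u n)) <= e.
Proof.
move=> uF e e0; have [N HN] := uF.1 e e0; exists N => n Nn.
have dr : represents (fun m => sip_add (u m) (sip_scale (- 1) (u n)))
    (F - to_completion (u n)).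
  rewrite -(scaleN1r (to_completion _)).
  exact: (representsD (- 1) uF (represents_cst (u n))).
rewrite -(@ler_pXn2r _ 2) ?nnegrE ?ipnorm_ge0 ?(ltW e0) // ipnorm_sqr.
set D : completion := F - to_completion (u n) in dr *.
rewrite -[@ip _ completion_ip D D]/(cdot D D); apply: (cvgr_to_le (cdotE dr dr)).
exists N => // m /= Nm; rewrite -ipnorm_sqr ler_pXn2r ?nnegrE ?ipnorm_ge0 ?(ltW e0) //.
exact: ltW (HN _ _ _ _).
Qed.

Lemma completion_complete (u : nat -> completion_ip) :
  (forall e : R, 0 < e -> exists N, forall m n,
     (N <= m)%N -> (N <= n)%N -> ipnorm (sip_sub (u m) (u n)) < e) ->
  exists F : completion_ip, forall e : R, 0 < e -> exists N, forall n,
     (N <= n)%N -> ipnorm (sip_sub (u n) F) < e.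
Proof.
move=> uC.
pose j x : completion_ip := to_completion x.
have subE (F G : completion_ip) : sip_sub F G = (F : completion) - G.
  by rewrite /sip_sub /= scaleN1r.
(* A diagonal sequence in [X]: being ever closer to [u n], it is Cauchy as well, and it represents
   the limit. *)
have /choice[c cP] n : exists x : X,
    ipnorm (sip_sub (u n) (j x)) <= n.+1%:R^-1.
  have n0 : 0 < n.+1%:R^-1 :> R by rewrite invr_gt0.
  have [N /(_ N (leqnn N)) HN] := represents_dist (approxP (u n)) n0.
  by exists (approx (u n) N); rewrite subE.
have small (e : R) : 0 < e -> exists N, forall n, (N <= n)%N -> n.+1%:R^-1 < e.
  move=> e0; have [N _ HN] := near_infty_natSinv_lt (PosNum e0).
  by exists N => n /HN.
have cC : sip_cauchy c.
  move=> e e0; have e3 : 0 < e / 3 :> R by rewrite divr_gt0.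
  have [N1 H1] := uC _ e3; have [N2 H2] := small _ e3.
  exists (maxn N1 N2) => m n; rewrite !geq_max.
  move=> /andP[N1m N2m] /andP[N1n N2n].
  have -> : ipnorm (sip_sub (c m) (c n)) = ipnorm
      (sip_sub (j (c m)) (j (c n))).
    rewrite /ipnorm !(ipBl, ipBr) /= !cdot_to_completion /=.
    by rewrite (ipC (c n)).
  apply: le_lt_trans (ipnormB_trans (u m) _ _) _; rewrite ipnormBC.
  apply: le_lt_trans (lerD (cP m) (ipnormB_trans (u n) _ _)) _.
  have := cP n; have := H2 _ N2m; have := H2 _ N2n; have := H1 _ _ N1m N1n.
  move: (ipnorm _) (ipnorm _) n.+1%:R^-1 m.+1%:R^-1.
  by clear => a b p q; lra.
have Fex x : exists l : R, (fun n => ip (c n) x) @ \oo --> l.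
  by apply: (ip_cauchy_cvg cC (represents_cst x).1).
have /choice[F HF] := Fex.
have Fin : F \in in_completion by apply/asboolP; exists c; split.
exists (Completion Fin) => e e0.
have e3 : 0 < e / 3 by rewrite divr_gt0.
have [N1 H1] := @represents_dist c (Completion Fin) (conj cC HF) _ e3.
have [N2 H2] := small _ e3.
exists (maxn N1 N2) => n; rewrite geq_max => /andP[N1n N2n].
apply: le_lt_trans (ipnormB_trans (j (c n)) _ _) _.
rewrite [X in _ + X < _]ipnormBC [X in _ + ipnorm X < _]subE.
have h1 : @ipnorm _ completion_ip ((Completion Fin : completion) - j (c n)) <= e / 3.
  exact: H1.
apply: le_lt_trans (lerD (cP n) h1) _.
have := H2 _ N2n; move: n.+1%:R^-1 => p; clear -e0; lra.
Qed.

End Completion.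

(** * Complex Hilbert spaces and unitary representations from real forms *)

Section DotBuild.
Context {R : realType} {V : lmodType R[i]} (f : V -> V -> R[i]).
Hypothesis fP : forall z, scalar (f^~ z).
Hypothesis fC : forall x y, f x y = (f y x)^*%C.
Hypothesis f_gt0 : forall x, x != 0 -> 0 < f x x.

(** [f] is a variable; packing it with its laws gives a constant to which the canonical instances
    can be attached. *)
Definition dot_fun (_ : forall z, scalar (f^~ z))
  (_ : forall x y, f x y = (f y x)^*%C) := f.
Local Notation g := (dot_fun fP fC).

Fact dot_fun_bilinear : bilinear_for *%R (@Num.conj R[i] \; *%R) g.
Proof.
split=> [y|x a y z]; first exact: fP.
rewrite /dot_fun fC fP (fC x y) (fC x z).
by rewrite -[conjc]/(@Num.conj R[i]) rmorphD rmorphM.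
Qed.

HB.instance Definition _ := bilinear_isBilinear.Build _ _ _ _ _ _ g
  dot_fun_bilinear.
Fact dot_fun_hermitian x y : g x y = (-1) ^+ false * (Num.conj (g y x)).
Proof. by rewrite expr0 mul1r /dot_fun fC. Qed.
HB.instance Definition _ := isHermitianSesquilinear.Build _ _ _ _ g
  dot_fun_hermitian.
HB.instance Definition _ := isDotProduct.Build _ _ g f_gt0.

Definition dot_of : {dot V for @Num.conj R[i]} := g.

End DotBuild.

(** A separate name for the pairs x + i y, so that scaling by [R[i]] does not meet the componentwise
    scaling of the product. The kernels below are real, whereas [property_T] speaks of complex
    Hilbert spaces. *)
Definition complexified (R : Type) (V : Type) : Type := (V * V)%type.

Section Complexification.
Context {R : realType} {V : lmodType R}.
Local Notation VC := (complexified R V).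

HB.instance Definition _ := GRing.Zmodule.copy VC (V * V)%type.

Definition complexified_scale (a : R[i]) (p : VC) : VC :=
  (complex.Re a *: p.1 - complex.Im a *: p.2,
   complex.Re a *: p.2 + complex.Im a *: p.1).

Fact complexified_scaleA a b p :
  complexified_scale a (complexified_scale b p) = complexified_scale (a * b) p.
Proof.
case: a b p => [a1 a2] [b1 b2] [x y]; rewrite /complexified_scale /=.
congr pair; rewrite !(scalerBr, scalerDr, scalerBl, scalerDl) !scalerA ?opprD.
  by rewrite -!addrA; congr (_ + _); rewrite addrA addrC.
by rewrite -!addrA; congr (_ + _); rewrite addrA addrC.
Qed.
Fact complexified_scale1 : left_id 1 complexified_scale.
Proof.
by case=> x y; rewrite /complexified_scale /= !scale1r !scale0r subr0 addr0.
Qed.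
Fact complexified_scaleDr : right_distributive complexified_scale +%R.
Proof.
move=> [a b] [x1 x2] [y1 y2]; rewrite /complexified_scale /=.
rewrite /GRing.add /=; congr pair; rewrite !(scalerDr, opprD).
  by rewrite addrACA.
by rewrite addrACA.
Qed.
Fact complexified_scaleDl p : {morph complexified_scale^~ p : a b / a + b}.
Proof.
case: p => x y [a1 a2] [b1 b2]; rewrite /complexified_scale /=.
rewrite [RHS]/GRing.add /=; congr pair; rewrite !scalerDl ?opprD.
  by rewrite addrACA.
by rewrite addrACA.
Qed.
HB.instance Definition _ := GRing.Zmodule_isLmodule.Build R[i] VC
  complexified_scaleA complexified_scale1 complexified_scaleDr
  complexified_scaleDl.

End Complexification.

Lemma complex_mulD (R : rcfType) (a b u v w z : R) :
  (a +i* b) * (u +i* v) + (w +i* z) =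
  (a * u - b * v + w) +i* (a * v + b * u + z).
Proof. by simpc. Qed.

Section CompletionHilbert.
Context {R : realType} (X : semi_ip R).
Local Notation V := (completion X).
Local Notation VC := (complexified R V).
Implicit Types p q : VC.

Definition cdotc p q : R[i] :=
  (cdot p.1 q.1 + cdot p.2 q.2) +i* (cdot p.2 q.1 - cdot p.1 q.2).

Fact cdotc_scalar q : scalar (cdotc^~ q).
Proof.
move=> [a b] [x1 x2] [y1 y2]; case: q => z1 z2.
have NN (x z : V) : cdot (- x) z = - cdot x z.
  by rewrite -(scaleN1r x) cdotZl mulN1r.
rewrite /cdotc /= !cdotDl !NN !cdotZl.
rewrite complex_mulD.
move: (cdot x1 z1) (cdot x1 z2) (cdot x2 z1) (cdot x2 z2).
move: (cdot y1 z1) (cdot y1 z2) (cdot y2 z1) (cdot y2 z2).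
clear => *; congr (_ +i* _); ring.
Qed.

Fact cdotc_herm p q : cdotc p q = ((cdotc q p)^*)%C.
Proof.
by rewrite /cdotc /= opprB !(cdotC p.1) !(cdotC p.2).
Qed.

Fact cdotc_gt0 p : p != 0 -> 0 < cdotc p p.
Proof.
move=> p0; rewrite /cdotc (cdotC p.2 p.1) subrr ltcE /= eqxx /=.
rewrite lt_def addr_ge0 ?cdot_ge0 // andbT; apply: contra_neq p0 => /eqP.
rewrite paddr_eq0 ?cdot_ge0 // => /andP[/eqP/cdot_eq0 p1 /eqP/cdot_eq0 p2].
by move: p p1 p2 => [? ?] /= -> ->.
Qed.

Definition completion_dot := dot_of cdotc_scalar cdotc_herm cdotc_gt0.

Lemma completion_dot_norm p :
  dot_norm completion_dot p = Num.sqrt (cdot p.1 p.1 + cdot p.2 p.2).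
Proof. by []. Qed.

Fact completion_dot_complete (u : nat -> VC) :
  (forall e : R, 0 < e -> exists N : nat, forall m n : nat,
     (N <= m)%N -> (N <= n)%N -> dot_norm completion_dot (u m - u n) < e) ->
  exists l : VC, (fun n => dot_norm completion_dot (u n - l)) @ \oo --> (0 : R).
Proof.
move=> uC.
have subE (F G : completion_ip X) : sip_sub F G = (F : V) - G.
  by rewrite /sip_sub /= scaleN1r.
have [|F1 H1] := @completion_complete _ X (fun n => (u n).1).
  move=> e /uC[N HN]; exists N => m n Nm Nn; apply: le_lt_trans (HN _ _ Nm Nn).
  by rewrite completion_dot_norm subE ler_wsqrtr // lerDl cdot_ge0.
have [|F2 H2] := @completion_complete _ X (fun n => (u n).2).
  move=> e /uC[N HN]; exists N => m n Nm Nn; apply: le_lt_trans (HN _ _ Nm Nn).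
  by rewrite completion_dot_norm subE ler_wsqrtr // lerDr cdot_ge0.
exists (F1, F2); apply/cvgn_epsP => e e0.
have e2 : 0 < e / 2 by rewrite divr_gt0.
have [N1 {}H1] := H1 _ e2; have [N2 {}H2] := H2 _ e2.
exists (maxn N1 N2) => n; rewrite geq_max => /andP[/H1 h1 /H2 h2].
rewrite subr0 completion_dot_norm ger0_norm ?sqrtr_ge0 //.
rewrite -(@ltr_pXn2r _ 2) ?nnegrE ?sqrtr_ge0 ?(ltW e0) //.
rewrite sqr_sqrtr ?addr_ge0 ?cdot_ge0 //=.
have sq (F : completion_ip X) : ipnorm F < e / 2 -> cdot F F < (e / 2) ^+ 2.
  by rewrite -[cdot F F]/(ip F F) -ipnorm_sqr ltr_pXn2r ?nnegrE ?ipnorm_ge0 ?(ltW e2).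
move: h1 h2; rewrite !subE => /sq h1 /sq h2.
apply: lt_le_trans (ltrD h1 h2) _.
by clear -e; have := sqr_ge0 e; rewrite !exprMn; lra.
Qed.

Definition completion_hilbert : hilbert R := Hilbert completion_dot_complete.

Definition to_hilbert (x : X) : completion_hilbert := (to_completion x, 0).

Lemma hnorm_to_hilbertB x y :
  hnorm (to_hilbert x - to_hilbert y) = ipnorm (sip_sub x y).
Proof.
have cN (F G : V) : cdot (F - G) (F - G) = cdot F F - cdot F G *+ 2 + cdot G G.
  have dl (A B C : V) : cdot (A - B) C = cdot A C - cdot B C.
    by rewrite -(scaleN1r B) cdotDl cdotZl mulN1r.
  rewrite dl !(cdotC _ (F - G)) !dl (cdotC G F).
  by move: (cdot F F) (cdot F G) (cdot G G); clear => *; ring.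
rewrite [LHS]completion_dot_norm /= !subrr cdot0l addr0 cN.
rewrite !cdot_to_completion /=; congr Num.sqrt.
by rewrite !(ipBl, ipBr) (ipC y x); ring.
Qed.

Lemma hnorm_to_hilbert x : hnorm (to_hilbert x) = ipnorm x.
Proof.
by rewrite [LHS]completion_dot_norm /= cdot_to_completion cdot0l addr0.
Qed.

End CompletionHilbert.

Section CompletionRep.
Context {R : realType} (X : semi_ip R) (G : groupType) (act : G -> X -> X).
Hypothesis act_ip : forall g x y, ip (act g x) (act g y) = ip x y.
Hypothesis act1 : forall x, act 1%g x = x.
Hypothesis actM : forall g h x, act (g * h)%g x = act g (act h x).
Local Notation V := (completion X).
Local Notation H := (completion_hilbert X).

Lemma ip_act_adj g x y : ip (act g x) y = ip x (act g^-1%g y).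
Proof. by rewrite -(act_ip g^-1%g) -actM mulVg act1. Qed.

Lemma represents_act g u (F : X -> R) : represents u F ->
  represents (act g \o u) (F \o act g^-1%g).
Proof.
move=> [uC uF]; split=> [e /uC[N HN]|x /=].
  exists N => m n Nm Nn; apply: le_lt_trans (HN _ _ Nm Nn).
  by rewrite /ipnorm !(ipBl, ipBr) /= !act_ip.
by under eq_fun do rewrite ip_act_adj; apply: uF.
Qed.

Lemma act_in_completion g (F : V) : F \o act g^-1%g \in @in_completion R X.
Proof.
apply/asboolP; have [u uF] := completion_ex F.
by exists (act g \o u); apply: represents_act.
Qed.

(** If [F] is the functional of u, this is the functional of its translate, as <g u, x> = <u, g^-1
    x>. *)
Definition rep_real g (F : V) : V := Completion (act_in_completion g F).

Definition rep_fun g (p : H) : H := (rep_real g p.1, rep_real g p.2).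

Fact rep_fun_linear g : linear (rep_fun g).
Proof.
move=> a [x1 x2] [y1 y2].
by congr pair; apply: val_inj; apply/funext => x.
Qed.

HB.instance Definition _ g :=
  GRing.isLinear.Build R[i] H H _ (rep_fun g) (rep_fun_linear g).

Definition rep_lin g : {linear H -> H} := rep_fun g.

Lemma cdot_rep_real g F1 F2 : cdot (rep_real g F1) (rep_real g F2) = cdot F1 F2.
Proof.
have [u uF] := completion_ex F1; have [v vF] := completion_ex F2.
have uF' : represents (act g \o u) (rep_real g F1) by apply: represents_act.
have vF' : represents (act g \o v) (rep_real g F2) by apply: represents_act.
apply: (cvgr_unique (cdotE uF' vF')) => /=.
by under eq_fun do rewrite act_ip; apply: cdotE.
Qed.

Lemma rep_linM g h x : rep_lin (g * h)%g x = rep_lin g (rep_lin h x).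
Proof.
by congr pair; apply: val_inj; apply/funext => y /=; rewrite invgM actM.
Qed.

Lemma rep_lin1 x : rep_lin 1%g x = x.
Proof.
case: x => x1 x2; congr pair; apply: val_inj; apply/funext => y /=.
  by rewrite invg1 act1.
by rewrite invg1 act1.
Qed.

Lemma rep_lin_unitary : unitary_rep rep_lin.
Proof.
split=> [g|]; last exact: rep_linM.
split=> [x y|y].
  by rewrite -[LHS]/(cdotc (rep_fun g x) (rep_fun g y)) /cdotc /= !cdot_rep_real.
by exists (rep_lin g^-1%g y); rewrite -rep_linM mulgV rep_lin1.
Qed.

Lemma rep_lin_to_hilbert g x : rep_lin g (to_hilbert x) = to_hilbert (act g x).
Proof.
by congr pair; apply: val_inj; apply/funext => y //=; rewrite ip_act_adj.
Qed.

(** The real or the imaginary part of [y] is nonzero and again fixed. Read as a function on [X], it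
    can be compared with constant functions. *)
Lemma rep_lin_fixed (y : H) : y != 0 -> (forall g, rep_lin g y = y) ->
  exists F : X -> R, [/\ exists x, F x != 0,
    exists M, forall x, F x ^+ 2 <= M * ip x x,
    forall x x', F (sip_add x x') = F x + F x',
    forall a x, F (sip_scale a x) = a * F x &
    forall g x, F (act g x) = F x].
Proof.
have suff_real (F : V) : F != 0 -> (forall g, rep_real g F = F) ->
    exists F : X -> R, [/\ exists x, F x != 0,
      exists M, forall x, F x ^+ 2 <= M * ip x x,
      forall x x', F (sip_add x x') = F x + F x',
      forall a x, F (sip_scale a x) = a * F x &
      forall g x, F (act g x) = F x].
  move=> F0 Finv; exists F; have [u [uC uF]] := completion_ex F.
  split=> [|||a x|g x].
  - apply: contrapT => H; case/eqP: F0; apply: val_inj; apply/funext => x /=.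
    by apply/eqP; apply/negPn/negP => Fx; apply: H; exists x.
  - by exists (cdot F F) => x; apply: completion_eval_bound.
  - move=> x x'; apply: (cvgr_unique (uF _)).
    by under eq_fun do rewrite ipDr; apply: cvgD.
  - apply: (cvgr_unique (uF _)).
    by under eq_fun do rewrite ipZr; apply: cvgM => //; apply: cvg_cst.
  - by rewrite -[in LHS](Finv g) /= -actM mulVg act1.
case: y => y1 y2 y0 yinv.
have [y10|y10] := eqVneq y1 0.
  apply: (suff_real y2) => [|g]; last by case: (yinv g).
  by apply: contra_neq y0 => ->; rewrite y10.
by apply: (suff_real y1) => // g; case: (yinv g).
Qed.

End CompletionRep.

(** * Positive definite kernels and property (T) *)

Section Kernel.
Context {R : realType} {T : Type}.
Implicit Types (K : T -> T -> R) (c d : seq (R * T)).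

Definition ksum K c d : R :=
  \sum_(x <- c) \sum_(y <- d) x.1 * y.1 * K x.2 y.2.

Definition kscale (a : R) c := [seq (a * x.1, x.2) | x <- c].

Definition psd K :=
  (forall x y, K x y = K y x) /\ (forall c, 0 <= ksum K c c).

Lemma ksum_catl K c c' d : ksum K (c ++ c') d = ksum K c d + ksum K c' d.
Proof. exact: big_cat. Qed.

Lemma ksum_scalel K a c d : ksum K (kscale a c) d = a * ksum K c d.
Proof.
rewrite /ksum big_map mulr_sumr; apply: eq_bigr => x _ /=.
by rewrite mulr_sumr; apply: eq_bigr => y _; rewrite !mulrA.
Qed.

Lemma ksumC K : (forall x y, K x y = K y x) ->
  forall c d, ksum K c d = ksum K d c.
Proof.
move=> KC c d; rewrite /ksum exchange_big; apply: eq_bigr => x _ /=.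
by apply: eq_bigr => y _; rewrite KC (mulrC y.1).
Qed.

Lemma ksum1 K a b x y : ksum K [:: (a, x)] [:: (b, y)] = a * b * K x y.
Proof. by rewrite /ksum !big_seq1. Qed.

(** The GNS space of the kernel before completion; [[:: (1, x)]] is the vector attached to the point
    [x]. *)
Definition kernel_ip K (KP : psd K) : semi_ip R :=
  SemiIp [::] (fun c c' d => ksum_catl K c c' d) (fun a c d => ksum_scalel K a c d)
    (ksumC KP.1) KP.2.

Lemma ksum_cstD K a c d :
  ksum (fun x y => K x y + a) c d =
  ksum K c d + a * ((\sum_(x <- c) x.1) * \sum_(y <- d) y.1).
Proof.
rewrite /ksum mulr_suml mulr_sumr -big_split; apply: eq_bigr => x _ /=.
rewrite mulr_sumr mulr_sumr -big_split; apply: eq_bigr => y _ /=; ring.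
Qed.

End Kernel.

Section PositiveDefinite.
Context {R : realType} {G : groupType}.
Implicit Types (f : G -> R) (c : seq (R * G)).

Definition posdef f := psd (fun g h : G => f (g^-1 * h)%g).

Definition cact (g : G) c := [seq (x.1, g * x.2)%g | x <- c].

Section Action.
Variables (f : G -> R) (fP : posdef f).
Local Notation X := (kernel_ip fP).

Lemma cact_ip g (c d : X) : ip (cact g c : X) (cact g d) = ip c d.
Proof.
rewrite /= /ksum big_map; apply: eq_bigr => x _; rewrite big_map.
by apply: eq_bigr => y _ /=; rewrite invgM mulgA -(mulgA x.2^-1%g) mulVg mulg1.
Qed.

Lemma cact1 c : cact 1%g c = c.
Proof. by rewrite /cact -[RHS]map_id; apply: eq_map => -[a x]; rewrite mul1g. Qed.

Lemma cactM g h c : cact (g * h)%g c = cact g (cact h c).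
Proof.
by rewrite /cact -map_comp; apply: eq_map => -[a x] /=; rewrite mulgA.
Qed.
End Action.

Lemma posdef_ge0 f : posdef f -> 0 <= f 1%g.
Proof.
by move=> [_ /(_ [:: (1, 1%g)])]; rewrite ksum1 !mul1r mulVg.
Qed.

Lemma posdefV f g : posdef f -> f g^-1%g = f g.
Proof. by case=> /(_ g 1%g); rewrite mulg1 invg1 mul1g. Qed.

(* By maximality the reproducing kernel space of [f - a] contains no nonzero
   constant function, i.e. no nonzero invariant vector. *)
Lemma posdef_max_cst f : posdef f -> exists a,
  posdef (fun g => f g - a) /\
  forall b, 0 < b -> ~ posdef (fun g => f g - a - b).
Proof.
move=> fP; pose S : set R := [set a | posdef (fun g => f g - a)].
have Sle a : S a -> a <= f 1%g by move=> /posdef_ge0; rewrite subr_ge0.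
have S0 : S 0.
  by rewrite /S /=; under eq_fun do rewrite subr0.
have Ssup : has_sup S by split; [exists 0|exists (f 1%g) => a /Sle].
have supP : posdef (fun g => f g - sup S).
  split=> [g h|c]; first by rewrite fP.1.
  rewrite ksum_cstD mulNr subr_ge0 -expr2.
  set s := \sum_(x <- c) x.1.
  (* For a fixed [c], positivity of [f - a] says that [a * s ^+ 2] is at most the sum for [f], a
     condition that passes to the supremum of the [a]. *)
  have [->|s0] := eqVneq s 0; first by rewrite expr0n mulr0 fP.2.
  have s20 : 0 < s ^+ 2 by rewrite lt_def sqrf_eq0 s0 sqr_ge0.
  rewrite -ler_pdivlMr //; apply: ge_sup; first by exists 0.
  move=> a [_ /(_ c)]; rewrite ksum_cstD mulNr subr_ge0 -expr2 -/s.
  by rewrite ler_pdivlMr.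
exists (sup S); split=> // b b0 SbP.
have : S (sup S + b).
  by rewrite /S /=; under eq_fun do rewrite opprD addrA.
by move=> /(ub_le_sup Ssup.2); rewrite gerDl leNgt b0.
Qed.

(** Once the largest constant is subtracted, the GNS representation has no nonzero invariant vector,
    so by (T) some [q] moves the cyclic vector [om], unless [om] is null. The squared displacement
    of [om] by [q] is [2 * (f 1 - f q)], in which [a] cancels. *)
Lemma property_T_posdef : property_T R G ->
  exists (Q : seq G) (e : R), 0 < e /\
    forall f, posdef f -> exists a,
      posdef (fun g => f g - a) /\
      (f 1%g = a \/
       exists2 q, q \in Q & e ^+ 2 * (f 1%g - a) <= 2 * (f 1%g - f q)).
Proof.
move=> [Q [e [e0 TP]]]; exists Q, e; split=> // f fP.
have [a [f0P amax]] := posdef_max_cst fP; exists a; split=> //.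
set f0 := fun g => f g - a in f0P.
pose X := kernel_ip f0P; pose act g (c : X) : X := cact g c.
have actip g (c d : X) : ip (act g c) (act g d) = ip c d by exact: cact_ip.
have act1 (c : X) : act 1%g c = c by exact: cact1.
have actM g h (c : X) : act (g * h)%g c = act g (act h c) by exact: cactM.
pose om : X := [:: (1, 1%g)].
have ip_om g h : ip (act g om) (act h om) = f0 (g^-1 * h)%g.
  by rewrite /= ksum1 /= !mulg1 !mul1r.
have [x0|x0] := eqVneq (to_hilbert om) 0.
  left; apply/eqP; rewrite -subr_eq0 -[_ - _]/(f0 1%g) -(mulVg 1%g) -ip_om !act1.
  rewrite -ipnorm_sqr -hnorm_to_hilbert x0 sqrf_eq0.
  by rewrite /hnorm /dot_norm linear0r sqrtr0.
right; apply: contrapT => noq.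
have [|y y0 yinv] := TP _ _ (rep_lin_unitary actip act1 actM).
  exists (to_hilbert om) => // g gQ.
  rewrite rep_lin_to_hilbert hnorm_to_hilbertB hnorm_to_hilbert.
  rewrite -(@ltr_pXn2r _ 2) ?nnegrE ?mulr_ge0 ?ipnorm_ge0 ?(ltW e0) //.
  rewrite exprMn !ipnorm_sqr !(ipBl, ipBr) -(act1 om) -!actM !ip_om.
  rewrite !mulg1 !mulVg invg1 !mul1g !(posdefV _ f0P) ltNge.
  apply/negP => h; apply: noq; exists g => //; apply: le_trans h _.
  by rewrite /f0; lra.
have [F [[z Fz] [M FM] FD FZ Finv]] := rep_lin_fixed y0 yinv.
pose k := F om.
(* Invariance makes [F] constant on point masses. Its boundedness then says that [k ^+ 2 / M] can
   still be subtracted from the kernel, against the maximality of [a]. *)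
have Fsum (c : X) : F c = k * \sum_(x <- c) x.1.
  elim: c => [|[r g] c IH].
    by rewrite big_nil mulr0 -[[::]]/(sip_scale 0 (sip0 : X)) FZ mul0r.
  rewrite big_cons mulrDr -IH -[_ :: c]/(sip_add ([:: (r, g)] : X) c) FD.
  congr (_ + _).
  rewrite -[(r, g)]/((r, g).1, (r, g).2) /= -[X in (X, _)]mulr1 -[X in (_, X)]mulg1.
  rewrite -[[:: _]]/(sip_scale r (act g om)) FZ Finv.
  by rewrite mulrC.
have k0 : k != 0 by apply: contra_neq Fz; rewrite Fsum => ->; rewrite mul0r.
have M0 : 0 < M.
  rewrite ltNge; apply/negP => M0; have := FM z.
  have := sqr_ge0 (F z) => F2; have F3 : 0 < F z ^+ 2 by rewrite lt_def sqrf_eq0 Fz.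
  have := ip_ge0 z => /(mulr_le0_ge0 M0); lra.
apply: (amax (k ^+ 2 / M)).
  by rewrite divr_gt0 // lt_def sqrf_eq0 k0 sqr_ge0.
split=> [g h|c]; first by rewrite fP.1.
rewrite (@ksum_cstD _ _ (fun x y => f (x^-1 * y)%g - a)) mulNr subr_ge0.
rewrite -expr2 mulrAC -exprMn ler_pdivrMr // [leRHS]mulrC.
by have := FM c; rewrite (Fsum c).
Qed.

End PositiveDefinite.

Lemma cvgr_sum (R : realType) (I J : Type) (F : set_system I) {FF : Filter F}
    (r : seq J) (u : J -> I -> R) (l : J -> R) :
  (forall j, u j i @[i --> F] --> l j) ->
  \sum_(j <- r) u j i @[i --> F] --> \sum_(j <- r) l j.
Proof. by move=> ul; apply: cvg_big => //; apply: add_continuous. Qed.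

(** * Operations preserving positive semidefinite kernels *)

Section PsdClosure.
Context {R : realType} {T : eqType}.
Implicit Types (K L : T -> T -> R) (c : seq (R * T)).

Lemma ksumE K K' c d : (forall x y, x \in map snd c -> y \in map snd d ->
  K x y = K' x y) -> ksum K c d = ksum K' c d.
Proof.
move=> KK'; apply: eq_big_seq => x xc; apply: eq_big_seq => y yd.
by rewrite KK' //; apply: map_f.
Qed.

Lemma psd_ext K K' : (forall x y, K x y = K' x y) -> psd K -> psd K'.
Proof.
move=> KK' [KC K0]; split=> [x y|c]; first by rewrite -!KK'.
by rewrite -(@ksumE K) // => x y _ _; rewrite KK'.
Qed.

Lemma psd_cvg (I : Type) (F : set_system I) (FF : ProperFilter F)
  (K_ : I -> T -> T -> R) K :
  (forall i, psd (K_ i)) -> (forall x y, K_ i x y @[i --> F] --> K x y) ->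
  psd K.
Proof.
move=> K_P K_K; split=> [x y|c].
  apply: (cvgr_unique (K_K x y)).
  by under eq_fun do rewrite (K_P _).1; apply: K_K.
have : ksum (K_ i) c c @[i --> F] --> ksum K c c.
  rewrite /ksum; apply: cvgr_sum => x; apply: cvgr_sum => y.
  by apply: cvgM; [apply: cvg_cst|apply: K_K].
move/cvgr_to_ge; apply; apply: nearW => i.
exact: (K_P i).2.
Qed.

Lemma psdD K L : psd K -> psd L -> psd (fun x y => K x y + L x y).
Proof.
move=> [KC K0] [LC L0]; split=> [x y|c]; first by rewrite KC LC.
suff -> : ksum (fun x y => K x y + L x y) c c = ksum K c c + ksum L c c.
  exact: addr_ge0.
rewrite /ksum -big_split; apply: eq_bigr => x _; rewrite -big_split.
by apply: eq_bigr => y _; rewrite /= mulrDr.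
Qed.

Lemma psdZ (a : R) K : 0 <= a -> psd K -> psd (fun x y => a * K x y).
Proof.
move=> a0 [KC K0]; split=> [x y|c]; first by rewrite KC.
suff -> : ksum (fun x y => a * K x y) c c = a * ksum K c c by exact: mulr_ge0.
rewrite /ksum mulr_sumr; apply: eq_bigr => x _; rewrite mulr_sumr.
by apply: eq_bigr => y _; rewrite mulrCA.
Qed.

Lemma psd_conj (h : T -> R) K : psd K -> psd (fun x y => h x * h y * K x y).
Proof.
move=> [KC K0]; split=> [x y|c]; first by rewrite KC (mulrC (h x)).
have := K0 [seq (x.1 * h x.2, x.2) | x <- c].
rewrite /ksum big_map; under eq_bigr do rewrite big_map.
congr (0 <= _); apply: eq_bigr => x _; apply: eq_bigr => y _ /=; ring.
Qed.

Lemma psd_cst (a : R) : 0 <= a -> psd (fun _ _ : T => a).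
Proof.
move=> a0; split=> // c.
suff -> : ksum (fun _ _ : T => a) c c = a * (\sum_(x <- c) x.1) ^+ 2.
  by rewrite mulr_ge0 ?sqr_ge0.
rewrite expr2 mulr_suml mulr_sumr; apply: eq_bigr => x _.
by rewrite !mulr_sumr; apply: eq_bigr => y _; rewrite mulrC.
Qed.

Lemma psd_gram (X : semi_ip R) (x : T -> X) : psd (fun a b => ip (x a) (x b)).
Proof.
split=> [a b|c]; first exact: ipC.
have [z zE] : exists z : X, forall y, \sum_(a <- c) a.1 * ip (x a.2) y = ip z y.
  elim: c => [|[r a] c [z IH]].
    by exists (sip_scale 0 (@sip0 _ X)) => y; rewrite big_nil ipZl mul0r.
  exists (sip_add (sip_scale r (x a)) z) => y.
  by rewrite big_cons IH ipDl ipZl.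
suff -> : ksum (fun a b => ip (x a) (x b)) c c = ip z z by exact: ip_ge0.
rewrite -[RHS]zE; apply: eq_bigr => a _; rewrite ipC -zE mulr_sumr.
by apply: eq_bigr => b _; rewrite mulrA (ipC (x b.2)).
Qed.

(* Cholesky: each step splits off the row of the head [a], leaving the Schur
   complement, which is again psd and vanishes on [a]; when [K a a = 0] that row
   is zero and the junk value [x / 0 = 0] gives the right formula. *)
Lemma psd_sum_squares K (s : seq T) : psd K ->
  exists ls : seq (T -> R), forall x y, x \in s -> y \in s ->
    K x y = \sum_(l <- ls) l x * l y.
Proof.
elim: s K => [|a s IH] K KP; first by exists [::].
have cs x y : K x y ^+ 2 <= K x x * K y y.
  have := @cauchy_schwarz _ (kernel_ip KP) [:: (1, x)] [:: (1, y)].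
  by rewrite /= !ksum1 !mul1r.
have K0 x : K a a = 0 -> K a x = 0.
  by move=> Ka0; apply/eqP; rewrite -sqrf_eq0 eq_le sqr_ge0 andbT (le_trans (cs a x)) // Ka0 mul0r.
have Ka_ge0 : 0 <= K a a by have := KP.2 [:: (1, a)]; rewrite ksum1 !mul1r.
pose K' x y := K x y - K a x * K a y / K a a.
have K'P : psd K'.
  split=> [x y|c]; first by rewrite /K' KP.1 (mulrC (K a x)).
  pose b := ksum K [:: (1, a)] c.
  have -> : ksum K' c c = ksum K c c - b ^+ 2 / K a a.
    rewrite /b /ksum big_seq1 expr2 !mulr_suml -sumrB; apply: eq_bigr => x _.
    rewrite !(mulr_sumr, mulr_suml) -sumrB; apply: eq_bigr => y _ /=.
    by rewrite /K'; ring.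
  rewrite subr_ge0; have [Ka0|Ka0] := eqVneq (K a a) 0.
    by rewrite Ka0 invr0 mulr0 KP.2.
  rewrite ler_pdivrMr ?lt_def ?Ka0 // mulrC.
  have := @cauchy_schwarz _ (kernel_ip KP) [:: (1, a)] c.
  by rewrite /= ksum1 !mul1r.
have [ls lsE] := IH K' K'P.
have K'a x : K' a x = 0.
  rewrite /K'; have [Ka0|Ka0] := eqVneq (K a a) 0.
    by rewrite K0 // Ka0 invr0 mulr0 subrr.
  by rewrite mulrAC divff // mul1r subrr.
exists ((fun x => K a x / Num.sqrt (K a a)) ::
        [seq (fun x => if x == a then 0 else l x) | l <- ls]).
move=> x y xs ys; rewrite big_cons big_map.
have -> : K a x / Num.sqrt (K a a) * (K a y / Num.sqrt (K a a)) =
    K a x * K a y / K a a.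
  rewrite -[in RHS](sqr_sqrtr Ka_ge0) expr2 invfM; ring.
apply/eqP; rewrite addrC -subr_eq -/(K' x y); apply/eqP.
move: xs ys; rewrite !inE; have [->|xa] := eqVneq x a.
  by move=> _ _; rewrite K'a big1 // => l _; rewrite mul0r.
have [->|ya] := eqVneq y a.
  by move=> _ _; rewrite K'P.1 K'a big1 // => l _; rewrite mulr0.
by rewrite /= => xs ys; rewrite lsE.
Qed.

(** On finitely many points [K] is a sum of rank one kernels [l x * l y], and multiplying [L] by one
    of these only rescales the coefficients of a combination. *)
Lemma psd_schur K L : psd K -> psd L -> psd (fun x y => K x y * L x y).
Proof.
move=> KP LP; split=> [x y|c]; first by rewrite KP.1 LP.1.
have [ls lsE] := psd_sum_squares (map snd c) KP.
rewrite (@ksumE _ (fun x y => \sum_(l <- ls) l x * l y * L x y)); last first.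
  by move=> x y xc yc; rewrite lsE // mulr_suml.
suff -> : ksum (fun x y => \sum_(l <- ls) l x * l y * L x y) c c =
    \sum_(l <- ls) ksum (fun x y => l x * l y * L x y) c c.
  by apply: sumr_ge0 => l _; apply: (psd_conj l LP).2.
rewrite /ksum [RHS]exchange_big; apply: eq_bigr => x _ /=.
rewrite [RHS]exchange_big; apply: eq_bigr => y _ /=.
by rewrite mulr_sumr.
Qed.

(** The exponential series has nonnegative coefficients, and the powers of [K] are psd by
    [psd_schur]. *)
Lemma psd_exp K : psd K -> psd (fun x y => expR (K x y)).
Proof.
move=> KP.
apply: (@psd_cvg nat \oo _ (fun n x y => series (exp_coeff (K x y)) n)).
  elim=> [|n IH].
    by apply: (@psd_ext (fun=> fun=> 0)); [move=> x y; rewrite /series /= big_geq|apply: psd_cst].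
  apply: (@psd_ext (fun x y => series (exp_coeff (K x y)) n + n`!%:R^-1 * K x y ^+ n)).
    by move=> x y; rewrite /series /= big_nat_recr //=; congr (_ + _); apply: mulrC.
  apply: psdD => //; apply: psdZ; first by rewrite invr_ge0.
  elim: n {IH} => [|n IH].
    by apply: (@psd_ext (fun=> fun=> 1)); [move=> x y; rewrite expr0|apply: psd_cst].
  apply: (@psd_ext (fun x y => K x y * K x y ^+ n)).
    by move=> x y; rewrite exprS.
  exact: psd_schur.
move=> x y; rewrite /expR; exact: is_cvg_series_exp_coeff.
Qed.

Definition sqdist (X : semi_ip R) (x y : X) : R := ipnorm (sip_sub x y) ^+ 2.

Lemma sqdist_ip (X : semi_ip R) (x y : X) :
  sqdist x y = ip x x - ip x y *+ 2 + ip y y.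
Proof. by rewrite /sqdist ipnorm_sqr !(ipBl, ipBr) (ipC y x); ring. Qed.

(* [exp (- t |x - y|^2) = h x * h y * exp (2 t <x, y>)] with
   [h x = exp (- t |x|^2)]. *)
Lemma schoenberg (X : semi_ip R) (x : T -> X) (t : R) : 0 <= t ->
  psd (fun a b => expR (- (t * sqdist (x a) (x b)))).
Proof.
move=> t0; pose h a := expR (- (t * ip (x a) (x a))).
apply: (@psd_ext (fun a b => h a * h b * expR (t * 2 * ip (x a) (x b)))).
  move=> a b; rewrite /h -!expRD /sqdist ipnorm_sqr !(ipBl, ipBr).
  by rewrite (ipC (x b) (x a)); congr expR; ring.
apply: psd_conj; apply: psd_exp; apply: psdZ; last exact: psd_gram.
by rewrite mulr_ge0.
Qed.

End PsdClosure.

Lemma ultra_bounded_cvg (R : realType) (I : Type) (U : set_system I)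
    (UU : UltraFilter U) (u : I -> R) (M : R) :
  (forall i, `|u i| <= M) -> exists l : R, u i @[i --> U] --> l.
Proof.
move=> uM.
have UfU : UltraFilter (u i @[i --> U]).
  split=> [|G GF sUG]; first exact: fmap_proper_filter.
  rewrite predeqE => A; split=> [GA|]; last exact: sUG.
  have [//|UA] := in_ultra_setVsetC (u @^-1` A) UU.
  have GnA : G (~` A) by apply: sUG.
  by have /filter_ex[x []] : G (A `&` ~` A) by exact: filterI.
have := @segment_compact R (- M) M; rewrite compact_ultra => /(_ _ UfU).
case=> [|l [_ ul]]; last by exists l.
by apply: (@filterS _ U _ setT) => [i _|]; [rewrite /= in_itv /= -ler_norml|exact: filterT].
Qed.

(** * Words in the generators *)

Section Words.
Context {n : nat}.
Implicit Types (l : 'I_n * bool) (u v w : word n).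

Definition flip l : 'I_n * bool := (l.1, ~~ l.2).
Definition winv w : word n := rev (map flip w).

Lemma flipK : involutive flip.
Proof. by case=> i b; rewrite /flip /= negbK. Qed.

Lemma winvK : involutive winv.
Proof. by move=> w; rewrite /winv map_rev revK -map_comp map_id_in // => l _; rewrite /= flipK. Qed.

Lemma winv_cons l w : winv (l :: w) = winv w ++ [:: flip l].
Proof. by rewrite /winv /= rev_cons -cats1. Qed.

Section Value.
Context {G : groupType} (s : 'I_n -> G).

Lemma letter_val_flip l : letter_val s (flip l) = (letter_val s l)^-1%g.
Proof. by case: l => i []; rewrite /letter_val /= ?invgK. Qed.

Lemma word_val_nil : word_val s [::] = 1%g.
Proof. exact: big_nil. Qed.

Lemma word_val_cons l w : word_val s (l :: w) = (letter_val s l * word_val s w)%g.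
Proof. exact: big_cons. Qed.

Lemma word_val1 l : word_val s [:: l] = letter_val s l.
Proof. by rewrite word_val_cons word_val_nil mulg1. Qed.

Lemma word_val_cat u v : word_val s (u ++ v) = (word_val s u * word_val s v)%g.
Proof.
elim: u => [|l u IH] /=; first by rewrite word_val_nil mul1g.
by rewrite !word_val_cons IH mulgA.
Qed.

Lemma word_val_inv w : word_val s (winv w) = (word_val s w)^-1%g.
Proof.
elim: w => [|l w IH]; first by rewrite /winv /= word_val_nil invg1.
by rewrite winv_cons word_val_cat IH word_val1 letter_val_flip word_val_cons invgM.
Qed.

Lemma word_val_eqv rels u v :
  (forall r, r \in rels -> word_val s r = 1%g) ->
  word_eqv rels u v -> word_val s u = word_val s v.
Proof.
move=> rels1; elim=> {u v} //.
- by move=> u v w _ -> _ ->.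
- move=> u v i b; rewrite !word_val_cat !word_val_cons word_val_nil mulg1.
  by rewrite -[(i, ~~ b)]/(flip (i, b)) letter_val_flip mulgV mul1g.
- by move=> u r v /rels1 rE; rewrite !word_val_cat rE mul1g.
Qed.
End Value.

End Words.

Section Generators.
Context {R : realType} {G : groupType}.

Lemma posdef_bound (f : G -> R) g : posdef f -> `|f g| <= f 1%g.
Proof.
move=> fP; have := @cauchy_schwarz_norm _ (kernel_ip fP) [:: (1, 1%g)] [:: (1, g)].
rewrite /ipnorm /= !ksum1 !mul1r !mulVg invg1 mul1g => /le_trans; apply.
by rewrite -expr2 sqr_sqrtr // posdef_ge0.
Qed.

Lemma psd_sum (T : eqType) (J : Type) (r : seq J) (K : J -> T -> T -> R) :
  (forall j, psd (K j)) -> psd (fun x y => \sum_(j <- r) K j x y).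
Proof.
move=> KP; elim: r => [|j r IH].
  by apply: (@psd_ext _ _ (fun=> fun=> 0)); [move=> x y; rewrite big_nil|apply: psd_cst].
apply: (@psd_ext _ _ (fun x y => K j x y + \sum_(j <- r) K j x y)).
  by move=> x y; rewrite big_cons.
exact: psdD.
Qed.

(** On finitely many points the kernel is the sum, over the classes [z], of the rank one kernels of
    their indicators. *)
Lemma psd_same_class (T S : eqType) (r : T -> S) :
  psd (fun x y => (r x == r y)%:R : R).
Proof.
split=> [x y|c]; first by rewrite eq_sym.
pose zs := undup [seq r x.2 | x <- c].
rewrite (@ksumE _ _ _ (fun x y => \sum_(z <- zs) (r x == z)%:R * (r y == z)%:R * 1)).
  apply: (psd_sum _ _).2 => z; apply: psd_conj; exact: psd_cst.
move=> x y xc yc.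
have rx : r x \in zs.
  by rewrite mem_undup; case/mapP: xc => p pc ->; apply/mapP; exists p.
rewrite (bigD1_seq (r x)) ?undup_uniq //= eqxx mul1r mulr1 eq_sym.
by rewrite big1 ?addr0 // => z /negPf zx; rewrite eq_sym zx !mul0r.
Qed.

Lemma posdef_subgroup (S : G -> Prop) :
  S 1%g -> (forall g, S g -> S g^-1%g) ->
  (forall g h, S g -> S h -> S (g * h)%g) ->
  posdef (fun g => (`[< S g >])%:R : R).
Proof.
move=> S1 SV SM.
(* [r g] is the left coset of [g], and [g^-1 * h] lies in [S] exactly when [g] and [h] have the same
   coset. *)
pose r (g : G) : set G := [set h | S (g^-1 * h)%g].
apply: (@psd_ext _ _ (fun g h => (r g == r h)%:R)); last exact: psd_same_class.
move=> g h; congr (nat_of_bool _)%:R; apply/eqP/asboolP => [rgh|Sgh].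
  by have : r h h; [rewrite /r /= mulVg|rewrite -rgh].
apply/seteqP; split=> k /=; rewrite /r /=.
  by move=> /(SM _ _ (SV _ Sgh)); rewrite invgM invgK mulgA mulgK.
by move=> /(SM _ _ Sgh); rewrite -mulgA mulVKg.
Qed.

(* That the Kazhdan set generates comes from applying the bound to the
   indicator function of the subgroup it generates. *)
Lemma property_T_generators : property_T R G ->
  exists (n : nat) (s : 'I_n -> G) (C : R), [/\ 0 <= C,
    forall g, exists w, word_val s w = g &
    forall f, posdef f -> exists a, posdef (fun g => f g - a) /\
      f 1%g - a <= C * \sum_(l : 'I_n * bool) (f 1%g - f (letter_val s l))].
Proof.
move=> /property_T_posdef[Q [e [e0 TP]]].
pose n := size Q; pose s (i : 'I_n) := nth 1%g Q i.
exists n, s, (2 / e ^+ 2).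
have sQ q : q \in Q -> exists i, s i = q.
  move=> qQ; have iQ : (index q Q < n)%N by rewrite index_mem.
  by exists (Ordinal iQ); rewrite /s nth_index.
have sum_ge0 (f : G -> R) : posdef f ->
    0 <= \sum_(l : 'I_n * bool) (f 1%g - f (letter_val s l)).
  move=> fP; apply: sumr_ge0 => l _; rewrite subr_ge0.
  exact: le_trans (ler_norm _) (posdef_bound _ fP).
have e20 : 0 < e ^+ 2 by rewrite exprn_gt0.
split; first by rewrite divr_ge0 // ltW.
  pose S g := exists w, word_val s w = g.
  have SP : posdef (fun g => (`[< S g >])%:R : R).
    apply: posdef_subgroup => [|g [w <-]|g h [u <-] [v <-]].
    - by exists [::]; rewrite word_val_nil.
    - by exists (winv w); rewrite word_val_inv.
    - by exists (u ++ v); rewrite word_val_cat.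
  have SQ q : q \in Q -> S q.
    by move=> /sQ[i <-]; exists [:: (i, false)]; rewrite word_val1.
  have S1 : S 1%g by exists [::]; rewrite word_val_nil.
  have [a [aP aQ]] := TP _ SP.
  (* The indicator equals 1 on the Kazhdan set, so the displacement alternative also forces
     [1 - a <= 0]. Then the indicator minus 1 is positive definite with value 0 at the identity,
     hence zero everywhere. *)
  have a1 : a = 1.
    case: aQ => [<-|[q /SQ Sq]]; first by rewrite asboolT.
    have := posdef_ge0 aP; rewrite !asboolT // subrr mulr0 => a_le1.
    by rewrite pmulr_rle0 // => a_ge1; apply/eqP; rewrite eq_sym -subr_eq0 eq_le a_le1 a_ge1.
  move=> g; have /= := posdef_bound g aP; rewrite (asboolT S1) a1 subrr normr_le0.
  rewrite subr_eq0; have [//|nSg] := pselect (S g).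
  by rewrite asboolF // eq_sym oner_eq0.
move=> f fP; have [a [aP aQ]] := TP f fP; exists a; split=> //.
case: aQ => [fa|[q /sQ[i <-] h]].
  by rewrite {1}fa subrr mulr_ge0 ?divr_ge0 ?sum_ge0 // ltW.
rewrite mulrAC ler_pdivlMr // mulrC; apply: le_trans h _.
rewrite ler_pM2l // (bigD1 (i, false)) //= lerDl; apply: sumr_ge0 => l _.
by rewrite subr_ge0 (le_trans (ler_norm _) (posdef_bound _ fP)).
Qed.

End Generators.

(** * A spectral gap for almost representations *)

(* A unitary representation of the free group, up to null vectors; linearity
   of the operators in the sense of [ip] follows from [wr_adj]. *)
Record word_rep (R : realType) (n : nat) := WordRep {
  wr_ip :> semi_ip R;
  wr_op : 'I_n * bool -> wr_ip -> wr_ip;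
  wr_adj : forall l x y, ip (wr_op l x) y = ip x (wr_op (flip l) y);
  wr_iso : forall l x y, ip (wr_op l x) (wr_op l y) = ip x y
}.

Section WordRep.
Context {R : realType} {n : nat} {X : word_rep R n}.
Implicit Types (x y : X) (u v w : word n).

Definition wact w x : X := foldr (@wr_op _ _ X) x w.

Lemma wact_cat u v x : wact (u ++ v) x = wact u (wact v x).
Proof. exact: foldr_cat. Qed.

Lemma wact_adj w x y : ip (wact w x) y = ip x (wact (winv w) y).
Proof.
elim: w y => [|l w IH] y //=.
by rewrite wr_adj IH winv_cons wact_cat.
Qed.

Lemma wact_iso w x y : ip (wact w x) (wact w y) = ip x y.
Proof. by elim: w => //= l w IH; rewrite wr_iso. Qed.

Definition dist x y := ipnorm (sip_sub x y).

Lemma dist_ge0 x y : 0 <= dist x y. Proof. exact: ipnorm_ge0. Qed.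

Lemma distC x y : dist x y = dist y x. Proof. exact: ipnormBC. Qed.

Lemma dist_trans y x z : dist x z <= dist x y + dist y z.
Proof. exact: ipnormB_trans. Qed.

Lemma sqdistE x y : sqdist x y = dist x y ^+ 2. Proof. by []. Qed.

Lemma wact_dist w x y : dist (wact w x) (wact w y) = dist x y.
Proof. by rewrite /dist /ipnorm !(ipBl, ipBr) !wact_iso. Qed.

Definition energy x : R := \sum_(l : 'I_n * bool) sqdist (wr_op l x) x.

Lemma energy_ge0 x : 0 <= energy x.
Proof. by apply: sumr_ge0 => l _; apply: sqr_ge0. Qed.

Lemma dist_op_energy l x : dist (wr_op l x) x <= Num.sqrt (energy x).
Proof.
rewrite -[leLHS]ger0_norm ?dist_ge0 // -sqrtr_sqr ler_wsqrtr //.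
rewrite /energy (bigD1 l) //= lerDl; apply: sumr_ge0 => k _; exact: sqr_ge0.
Qed.

Lemma dist_wact_energy w x : dist (wact w x) x <= (size w)%:R * Num.sqrt (energy x).
Proof.
elim: w => [|l w IH] /=.
  by rewrite mul0r /dist /ipnorm !(ipBl, ipBr) subrr sqrtr0.
apply: le_trans (dist_trans (wr_op l x) _ _) _.
rewrite -natr1 mulrDl mul1r; apply: lerD (dist_op_energy l x).
by rewrite -[dist _ _]/(dist (wact [:: l] (wact w x)) (wact [:: l] x)) wact_dist.
Qed.

Definition sip_sum (r : seq ('I_n * bool)) (F : 'I_n * bool -> X) : X :=
  foldr (fun l => sip_add (F l)) (sip_scale 0 sip0) r.

Lemma ip_sum r F y : ip (sip_sum r F) y = \sum_(l <- r) ip (F l) y.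
Proof.
elim: r => [|l r IH] /=; first by rewrite big_nil ipZl mul0r.
by rewrite big_cons ipDl IH.
Qed.

(** The unnormalized Laplacian of the Cayley graph. As the letters are closed under inversion it is
    symmetric, and [energy] is twice its quadratic form. *)
Definition lap x : X :=
  sip_sum (index_enum _) (fun l => sip_sub x (wr_op l x)).

Lemma ip_lap x y :
  ip (lap x) y = \sum_(l : 'I_n * bool) (ip x y - ip (wr_op l x) y).
Proof. by rewrite ip_sum; apply: eq_bigr => l _; rewrite ipBl. Qed.

(** Polarization, 2 <a, b> = |a|^2 + |b|^2 - |a - b|^2, for a = x - l x and b = x - k x. Only
    displacements occur on the right, and these are what survives in the ultralimit. *)
Lemma ip_lap_lap x : ip (lap x) (lap x) *+ 2 =
  \sum_(l : 'I_n * bool) \sum_(k : 'I_n * bool)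
    (sqdist (wr_op l x) x + sqdist (wr_op k x) x
     - sqdist (wr_op l x) (wr_op k x)).
Proof.
rewrite {1}/lap ip_sum -sumrMnl; apply: eq_bigr => l _.
rewrite ipC {1}/lap ip_sum -sumrMnl; apply: eq_bigr => k _.
rewrite !sqdist_ip !wr_iso !(ipBl, ipBr).
by rewrite (ipC (wr_op k x) x) (ipC (wr_op l x) x) (ipC (wr_op k x) (wr_op l x)); ring.
Qed.

Lemma wact_winvK w x y : ip (wact (winv w) (wact w x)) y = ip x y.
Proof. by rewrite wact_adj winvK wact_iso. Qed.

End WordRep.

Arguments dist {R n X}.

(** The error is quadratic, which makes the difference quotients of exp (- t psi) at t = 0 converge
    to psi. *)
Lemma expRN_bounds (R : realType) (x : R) :
  0 <= x -> x - x ^+ 2 <= 1 - expR (- x) <= x.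
Proof.
move=> x0; have h1 := expR_ge1Dx (- x); have h2 := expR_ge1Dx x.
have h3 := expRxMexpNx_1 x; have h4 := expR_ge0 (- x).
apply/andP; split; last by lra.
suff : expR (- x) <= 1 - x + x ^+ 2 by lra.
have h5 : (1 + x) * expR (- x) <= 1 by rewrite -[leRHS]h3 ler_wpM2r.
have h6 : 1 <= (1 + x) * (1 - x + x ^+ 2).
  have -> : (1 + x) * (1 - x + x ^+ 2) = 1 + x ^+ 3 by ring.
  by rewrite lerDl exprn_ge0.
have x1 : 0 < 1 + x by lra.
by rewrite -(ler_pM2l x1) (le_trans h5).
Qed.

Lemma ksum_diff1 (R : realType) (T : Type) (K : T -> T -> R) x y z :
  ksum K [:: (1, x); (-1, y)] [:: (1, z)] = K x z - K y z.
Proof. by rewrite /ksum !big_cons !big_nil /=; ring. Qed.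

Lemma ksum_diff_diff (R : realType) (T : Type) (K : T -> T -> R) x y z w :
  ksum K [:: (1, x); (-1, y)] [:: (1, z); (-1, w)] =
  K x z - K x w - K y z + K y w.
Proof. by rewrite /ksum !big_cons !big_nil /=; ring. Qed.

(* The normalized displacements [|w xi - xi|^2 / energy xi] converge along an
   ultrafilter to a function of conditionally negative type, which descends to
   [G] since the relators act trivially in the limit. *)
Section UltraLimit.
Context {R : realType} {n : nat} {G : groupType} (s : 'I_n -> G).
Context (X : nat -> word_rep R n) (xi : forall m, X m).
Hypothesis energy_gt0 : forall m, 0 < energy (xi m).
Hypothesis almost_rep : forall r v, word_val s r = 1%g ->
  (fun m => sqdist (wact (r ++ v) (xi m)) (wact v (xi m)) / energy (xi m))
    @ \oo --> (0 : R).
Context (U : set_system nat) (UU : UltraFilter U) (ooU : \oo `<=` U).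

Definition disp m (w : word n) : R := sqdist (wact w (xi m)) (xi m) / energy (xi m).

Lemma disp_ge0 m w : 0 <= disp m w.
Proof. by rewrite divr_ge0 ?sqr_ge0 ?energy_ge0. Qed.

Lemma disp_le m w : disp m w <= (size w)%:R ^+ 2.
Proof.
rewrite ler_pdivrMr // -[X in _ * X](sqr_sqrtr (energy_ge0 _)) -exprMn.
by rewrite ler_pXn2r ?nnegrE ?dist_ge0 ?mulr_ge0 ?sqrtr_ge0 ?dist_wact_energy.
Qed.

Lemma disp_lim_ex w : exists l : R, disp m w @[m --> U] --> l.
Proof.
apply: (@ultra_bounded_cvg _ _ _ UU _ ((size w)%:R ^+ 2)) => m.
by rewrite ger0_norm ?disp_ge0 ?disp_le.
Qed.

Definition disp_lim w : R := projT1 (cid (disp_lim_ex w)).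

Lemma disp_limP w : disp m w @[m --> U] --> disp_lim w.
Proof. exact: projT2 (cid (disp_lim_ex w)). Qed.

Arguments disp_limP w : clear implicits.

Lemma disp_lim_ge0 w : 0 <= disp_lim w.
Proof.
by apply: (cvgr_to_ge (disp_limP w)); apply: nearW => m; apply: disp_ge0.
Qed.

(** The word [u ++ winv v] is trivial in [G], so [u] and [v] send [xi] to points whose normalized
    distance tends to 0. The square roots of the two displacements differ by at most that distance
    and are bounded by the word lengths, so the displacements merge too. *)
Lemma disp_lim_val u v : word_val s u = word_val s v -> disp_lim u = disp_lim v.
Proof.
move=> uv.
pose d m := dist (wact u (xi m)) (wact v (xi m)) / Num.sqrt (energy (xi m)).
have d0 : d m @[m --> \oo] --> (0 : R).
  have r1 : word_val s (u ++ winv v) = 1%g by rewrite word_val_cat word_val_inv uv mulgV.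
  have := almost_rep v r1 => /cvgn_epsP H; apply/cvgn_epsP => e e0.
  have [N HN] := H _ (exprn_gt0 2 e0); exists N => m /HN.
  rewrite !subr0 !ger0_norm ?divr_ge0 ?sqr_ge0 ?energy_ge0 ?dist_ge0 ?sqrtr_ge0 //.
  rewrite -[X in _ / X](sqr_sqrtr (energy_ge0 (xi m))) sqdistE -expr_div_n.
  rewrite ltr_pXn2r ?nnegrE ?divr_ge0 ?dist_ge0 ?sqrtr_ge0 ?(ltW e0) //.
  congr (_ / _ < _); rewrite /dist; congr Num.sqrt.
  have rE y : ip (wact u (wact (winv v) (wact v (xi m)))) y = ip (wact u (xi m)) y.
    by rewrite wact_adj wact_winvK -wact_adj.
  have rE' y : ip y (wact u (wact (winv v) (wact v (xi m)))) = ip y (wact u (xi m)).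
    by rewrite ipC rE ipC.
  by rewrite !(ipBl, ipBr) -catA !wact_cat !rE' !rE.
have sqd m w : dist (wact w (xi m)) (xi m) / Num.sqrt (energy (xi m)) = Num.sqrt (disp m w).
  rewrite /disp sqdistE sqrtrM ?sqr_ge0 // sqrtr_sqr ger0_norm ?dist_ge0 //.
  by rewrite sqrtrV ?energy_ge0.
have le1 m : `|disp m u - disp m v| <= d m * ((size u)%:R + (size v)%:R).
  rewrite -(sqr_sqrtr (disp_ge0 m u)) -(sqr_sqrtr (disp_ge0 m v)) subr_sqr normrM.
  apply: ler_pM => //; last first.
    rewrite ger0_norm ?addr_ge0 ?sqrtr_ge0 //; apply: lerD.
      by rewrite -[leRHS]ger0_norm // -sqrtr_sqr ler_wsqrtr ?disp_le.
    by rewrite -[leRHS]ger0_norm // -sqrtr_sqr ler_wsqrtr ?disp_le.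
  rewrite -!sqd -mulrBl normrM [X in _ * X]ger0_norm ?invr_ge0 ?sqrtr_ge0 //.
  rewrite ler_wpM2r ?invr_ge0 ?sqrtr_ge0 //.
  rewrite ler_norml; apply/andP; split.
    rewrite lerNl opprB lerBlDr.
    by apply: le_trans (dist_trans (wact u (xi m)) _ _) _; rewrite distC.
  by rewrite lerBlDr; apply: dist_trans.
have d0' : d m * ((size u)%:R + (size v)%:R) @[m --> \oo] --> (0 : R).
  by rewrite -[0](mul0r ((size u)%:R + (size v)%:R)); apply: cvgM d0 _; apply: cvg_cst.
have lim0 : disp m u - disp m v @[m --> \oo] --> (0 : R).
  apply/norm_cvg0P; apply: (squeeze_cvgr _ (cvg_cst 0) d0').
  by apply: nearW => m; rewrite normr_ge0 le1.
apply/eqP; rewrite -subr_eq0; apply/eqP.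
apply: (cvgr_unique (cvgB (disp_limP u) (disp_limP v))).
move=> A /lim0; exact: ooU.
Qed.

Hypothesis s_gen : forall g, exists w, word_val s w = g.

Definition rep_word g : word n := projT1 (cid (s_gen g)).

Lemma rep_wordK g : word_val s (rep_word g) = g.
Proof. exact: projT2 (cid (s_gen g)). Qed.

Lemma disp_winv_cat m u v : disp m (winv u ++ v) =
  sqdist (wact u (xi m)) (wact v (xi m)) / energy (xi m).
Proof.
rewrite /disp !sqdist_ip wact_cat !wact_iso wact_adj winvK.
by rewrite (ipC (wact v _)).
Qed.

(** For each [m] this is Schoenberg's kernel on the points [rep_word g] applied to [xi m]. It
    depends on the chosen words, and becomes a function of [g^-1 * h] only in the limit. *)
Lemma exp_disp_posdef (t : R) : 0 <= t ->
  posdef (fun g => expR (- (t * disp_lim (rep_word g)))).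
Proof.
move=> t0; apply: (@psd_cvg _ _ _ U _ (fun m g h => expR (- (t / energy (xi m) *
  sqdist (wact (rep_word g) (xi m)) (wact (rep_word h) (xi m)))))) => [m|g h].
  by apply: schoenberg; rewrite divr_ge0 ?energy_ge0.
have -> : disp_lim (rep_word (g^-1 * h)%g) =
    disp_lim (winv (rep_word g) ++ rep_word h).
  by apply: disp_lim_val; rewrite word_val_cat word_val_inv !rep_wordK.
apply: continuous_cvg; first exact: continuous_expR.
apply: cvgN; under eq_fun do rewrite -mulrA (mulrC _^-1) -disp_winv_cat.
by apply: cvgM; [apply: cvg_cst|apply: disp_limP].
Qed.

(* The bound given by (T) holds for the positive definite functions
   [exp (- t psi)], where [psi] is the limit displacement; divide by [t] and let
   [t] tend to 0. *)
Lemma disp_lim_bound (C : R) :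
  0 <= C -> (forall f, posdef f -> exists a, posdef (fun g => f g - a) /\
      f 1%g - a <= C * \sum_(l : 'I_n * bool) (f 1%g - f (letter_val s l))) ->
  \sum_(l : 'I_n * bool) disp_lim [:: l] <=
  C * \sum_(l : 'I_n * bool) \sum_(k : 'I_n * bool)
    (disp_lim [:: l] + disp_lim [:: k] - disp_lim [:: flip l; k]).
Proof.
move=> C0 TC.
pose e (t : R) w : R := 1 - expR (- (t * disp_lim w)).
have e_ge0 (t : R) w : 0 <= t -> 0 <= e t w.
  by move=> t0; rewrite subr_ge0 expR_le1 oppr_le0 mulr_ge0 ?disp_lim_ge0.
have main (t : R) : 0 <= t -> \sum_l e t [:: l] <=
    C * \sum_l \sum_k (e t [:: l] + e t [:: k] - e t [:: flip l; k]).
  move=> t0; pose f g := expR (- (t * disp_lim (rep_word g))).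
  have fE w : 1 - f (word_val s w) = e t w.
    by rewrite /f /e (@disp_lim_val _ w) // rep_wordK.
  have fP : posdef f by exact: exp_disp_posdef.
  have f1 : f 1%g = 1.
    have := fE [::]; rewrite word_val_nil /e => /(congr1 (fun x => 1 - x)).
    rewrite !subKr => ->; rewrite -[RHS]expR0; congr expR; apply/eqP.
    rewrite oppr_eq0 mulf_eq0; apply/orP; right.
    apply/eqP/(cvgr_unique (disp_limP [::])).
    suff -> : disp^~ [::] = fun=> 0 by apply: cvg_cst.
    by apply/funext => m; rewrite /disp sqdist_ip; ring.
  have [a [aP ale]] := TC f fP.
  have SE : \sum_l (f 1%g - f (letter_val s l)) = \sum_l e t [:: l].
    by apply: eq_bigr => l _; rewrite -fE f1 word_val1.
  rewrite SE in ale.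
  (* [c] is the formal Laplacian of the point mass at 1; its coefficients sum to 0, so [a] drops out
     of products with it. Let B be the product of [c] with itself. Cauchy-Schwarz against the point
     mass and the bound from (T) give P^2 <= B (1 - a) <= B C P, and P cancels. *)
  pose K g h := f (g^-1 * h)%g - a.
  pose h (l : 'I_n * bool) := [:: (1 : R, 1%g : G); (-1, letter_val s l)].
  pose c := flatten [seq h l | l <- index_enum ('I_n * bool)%type].
  have cl d : ksum K c d = \sum_l ksum K (h l) d.
    by rewrite /ksum big_flatten big_map.
  have KE g k : K g k = 1 - a - (1 - f (g^-1 * k)%g) by rewrite /K; ring.
  have K11 : K 1%g 1%g = 1 - a by rewrite KE mulVg f1; ring.
  have K1l l : K 1%g (letter_val s l) = 1 - a - e t [:: l].
    by rewrite KE invg1 mul1g -word_val1 fE.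
  have Kl1 l : K (letter_val s l) 1%g = 1 - a - e t [:: l].
    by rewrite -K1l; apply: aP.1.
  have Kll l k : K (letter_val s l) (letter_val s k) = 1 - a - e t [:: flip l; k].
    by rewrite KE -fE !word_val_cons word_val_nil mulg1 letter_val_flip.
  have c1 : ksum K c [:: (1, 1%g)] = \sum_l e t [:: l].
    by rewrite cl; apply: eq_bigr => l _; rewrite ksum_diff1 K11 Kl1; ring.
  have cc : ksum K c c =
      \sum_l \sum_k (e t [:: l] + e t [:: k] - e t [:: flip l; k]).
    have KC : forall c d, ksum K c d = ksum K d c by exact: (ksumC aP.1).
    rewrite cl; apply: eq_bigr => l _; rewrite KC cl.
    apply: eq_bigr => k _; rewrite KC ksum_diff_diff.
    rewrite K11 K1l Kl1 Kll.
    by move: (e t _) (e t _) (e t _) => p q r; clear; ring.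
  set P := \sum_l e t [:: l] in SE ale c1 *.
  have P0 : 0 <= P by apply: sumr_ge0 => l _; apply: e_ge0.
  have B0 := aP.2 c; rewrite -/(ksum K c c) in B0.
  have := @cauchy_schwarz _ (kernel_ip aP) c [:: (1, 1%g)].
  rewrite /= -![ksum _ _ _]/(ksum K _ _) c1 ksum1 !mul1r -cc /K mulVg f1.
  rewrite f1 in ale; move=> CS.
  have [P00|Ppos] := eqVneq P 0; first by rewrite P00 mulr_ge0.
  have PP : 0 < P by rewrite lt_def Ppos.
  rewrite -(ler_pM2r PP) -expr2; apply: le_trans CS _.
  by rewrite -mulrA mulrCA ler_wpM2l.
pose phi k w : R := k.+1%:R * e (k.+1%:R^-1) w.
have phi_cvg w : phi k w @[k --> \oo] --> disp_lim w.
  have scale k (y : R) : y = k.+1%:R * (k.+1%:R^-1 * y) :> R.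
    by rewrite mulrA divff ?mul1r // pnatr_eq0.
  have lo k : disp_lim w - disp_lim w ^+ 2 * harmonic k <= phi k w.
    have x0 : 0 <= k.+1%:R^-1 * disp_lim w.
      by rewrite mulr_ge0 ?disp_lim_ge0 ?invr_ge0.
    rewrite [leLHS](scale k) /phi ler_wpM2l //.
    have /andP[h _] := expRN_bounds x0; apply: le_trans h.
    rewrite /harmonic /=; move: k.+1%:R^-1 => i.
    by rewrite le_eqVlt; apply/orP; left; apply/eqP; ring.
  have up k : phi k w <= disp_lim w.
    have x0 : 0 <= k.+1%:R^-1 * disp_lim w.
      by rewrite mulr_ge0 ?disp_lim_ge0 ?invr_ge0.
    rewrite [leRHS](scale k) /phi ler_wpM2l //.
    by have /andP[_] := expRN_bounds x0.
  have hl : disp_lim w - disp_lim w ^+ 2 * harmonic k @[k --> \oo] --> disp_lim w.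
    rewrite -[X in _ --> X]subr0 -[0](mulr0 (disp_lim w ^+ 2)).
    apply: cvgB; first exact: cvg_cst.
    by apply: cvgM; [apply: cvg_cst|apply: cvg_harmonic].
  apply: (squeeze_cvgr _ hl (cvg_cst (disp_lim w))).
  by apply: nearW => k; rewrite lo up.
have lim1 : \sum_l phi k [:: l] @[k --> \oo] --> \sum_l disp_lim [:: l].
  exact: cvgr_sum.
have lim2 : C * \sum_l \sum_i (phi k [:: l] + phi k [:: i] - phi k [:: flip l; i])
    @[k --> \oo] --> C * \sum_l \sum_i
      (disp_lim [:: l] + disp_lim [:: i] - disp_lim [:: flip l; i]).
  apply: cvgM; first exact: cvg_cst.
  apply: cvgr_sum => l; apply: cvgr_sum => i.
  by apply: cvgB => //; apply: cvgD.
apply: (ler_cvg_to lim1 lim2); apply: nearW => k.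
have -> : \sum_l phi k [:: l] = k.+1%:R * \sum_l e k.+1%:R^-1 [:: l].
  by rewrite mulr_sumr.
have -> : \sum_l \sum_i (phi k [:: l] + phi k [:: i] - phi k [:: flip l; i]) =
  k.+1%:R * \sum_l \sum_i (e k.+1%:R^-1 [:: l] + e k.+1%:R^-1 [:: i] -
     e k.+1%:R^-1 [:: flip l; i]).
  rewrite mulr_sumr; apply: eq_bigr => l _; rewrite mulr_sumr.
  apply: eq_bigr => i _; rewrite /phi.
  by move: (e _ _) (e _ _) (e _ _) => a b c; rewrite mulrBr mulrDr.
rewrite mulrCA ler_wpM2l //; apply: main.
by rewrite invr_ge0.
Qed.

End UltraLimit.
Arguments disp_limP {R n X xi} energy_gt0 {U} UU w.

(** One good index suffices, since the lemma can be applied to a sequence consisting only of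
    counterexamples. In their ultralimit the displacements of the letters sum to 1 by normalization,
    while the squared Laplacian is at most [kappa]. *)
Lemma spectral_gap (R : realType) (n : nat) (G : groupType) (s : 'I_n -> G)
    (C : R) :
  (forall g, exists w, word_val s w = g) -> 0 <= C ->
  (forall f, posdef f -> exists a, posdef (fun g => f g - a) /\
      f 1%g - a <= C * \sum_(l : 'I_n * bool) (f 1%g - f (letter_val s l))) ->
  exists kappa : R, 0 < kappa /\
  forall (X : nat -> word_rep R n) (xi : forall m, X m),
    (forall m, 0 < energy (xi m)) ->
    (forall r v, word_val s r = 1%g ->
      (fun m => sqdist (wact (r ++ v) (xi m)) (wact v (xi m)) / energy (xi m))
        @ \oo --> (0 : R)) ->
    exists m, kappa * energy (xi m) < ip (lap (xi m)) (lap (xi m)).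
Proof.
(* [disp_lim_bound] will read 1 <= C (2 kappa), and this [kappa] makes the right side at most
   1/2. *)
move=> s_gen C0 TC; pose kappa := (4 * (C + 1))^-1.
have k0 : 0 < kappa by rewrite invr_gt0 mulr_gt0 // ltr_wpDl.
exists kappa; split=> // X xi E0 rep; apply: contrapT => noex.
have le m : ip (lap (xi m)) (lap (xi m)) <= kappa * energy (xi m).
  rewrite leNgt; apply/negP => h. by apply: noex; exists m.
have [U [UU ooU]] := @ultraFilterLemma nat \oo _.
have dP w := disp_limP E0 UU w.
have bound := @disp_lim_bound R n G s X xi E0 rep U UU ooU s_gen C C0 TC.
have sum1 : \sum_(l : 'I_n * bool) disp_lim E0 UU [:: l] = 1.
  have h : \sum_(l : 'I_n * bool) disp xi m [:: l] @[m --> U] -->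
      \sum_(l : 'I_n * bool) disp_lim E0 UU [:: l] by apply: cvgr_sum.
  apply: (cvgr_unique h).
  suff -> : (fun m => \sum_(l : 'I_n * bool) disp xi m [:: l]) = fun=> 1.
    exact: cvg_cst.
  apply/funext => m; rewrite /disp -mulr_suml -[X in X / _]/(energy (xi m)).
  by rewrite divff // gt_eqF.
rewrite sum1 in bound.
set S := \sum_l _ in bound.
have S_le : S <= 2 * kappa.
  have h : \sum_(l : 'I_n * bool) \sum_(k : 'I_n * bool)
      (disp xi m [:: l] + disp xi m [:: k] - disp xi m [:: flip l; k]) @[m --> U]
      --> S.
    by apply: cvgr_sum => l; apply: cvgr_sum => k; apply: cvgB => //; apply: cvgD.
  apply: (cvgr_to_le h); apply: nearW => m.
  have -> : \sum_(l : 'I_n * bool) \sum_(k : 'I_n * bool)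
      (disp xi m [:: l] + disp xi m [:: k] - disp xi m [:: flip l; k]) =
      ip (lap (xi m)) (lap (xi m)) *+ 2 / energy (xi m).
    rewrite ip_lap_lap mulr_suml; apply: eq_bigr => l _.
    rewrite mulr_suml; apply: eq_bigr => k _.
    rewrite -[[:: flip l; k]]/(winv [:: l] ++ [:: k]) disp_winv_cat.
    by rewrite mulrBl mulrDl.
  by rewrite ler_pdivrMr // -mulrA mulr_natl !mulr2n lerD.
have : C * S <= C * (2 * kappa) by rewrite ler_wpM2l.
move/(le_trans bound); apply/negP; rewrite -ltNge /kappa invfM.
have C1 : 0 < C + 1 by rewrite ltr_wpDl.
have : C * (C + 1)^-1 <= 1 by rewrite ler_pdivrMr // mul1r lerDl.
lra.
Qed.

(** * Random walk towards invariant vectors *)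

Section Walk.
Context {R : realType} {n : nat} {X : word_rep R n}.
Implicit Types (x y z : X).
Local Notation L := ('I_n * bool)%type.
Local Notation N := (#|{: L}|%:R : R).

(** Without a quotient, having the same products replaces equality of vectors. *)
Lemma ipnorm_ext x y : (forall z, ip x z = ip y z) -> ipnorm x = ipnorm y.
Proof. by move=> xy; rewrite /ipnorm xy ipC xy. Qed.

Lemma ipnorm_sum (r : seq L) (F : L -> X) :
  ipnorm (sip_sum r F) <= \sum_(l <- r) ipnorm (F l).
Proof.
elim: r => [|l r IH] /=; first by rewrite big_nil ipnormZ normr0 mul0r.
by rewrite big_cons; apply: le_trans (ipnormD _ _) _; rewrite lerD2l.
Qed.

Lemma lap_adj x y : ip (lap x) y = ip x (lap y).
Proof.
rewrite (ipC x) !ip_lap !sumrB; congr (_ - _).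
  by apply: eq_bigr => l _; rewrite ipC.
rewrite (reindex_inj (can_inj (@flipK n))); apply: eq_bigr => l _.
by rewrite wr_adj flipK ipC.
Qed.

Lemma energy_lap x : energy x = ip (lap x) x *+ 2.
Proof.
rewrite ip_lap -sumrMnl; apply: eq_bigr => l _.
by rewrite sqdist_ip wr_iso; ring.
Qed.

Lemma energy_le x : energy x <= 4 * N * ip x x.
Proof.
have -> : 4 * N * ip x x = \sum_(l : L) 4 * ip x x.
  by rewrite sumr_const -[RHS]mulr_natl mulrCA mulrA.
apply: ler_sum => l _; rewrite sqdist_ip wr_iso.
have := cauchy_schwarz_norm (wr_op l x) x.
rewrite {1}/ipnorm wr_iso -/(ipnorm x) -expr2 ipnorm_sqr ler_norml => /andP[+ _].
by rewrite lerNl; lra.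
Qed.

(** [N * step_size <= 1 / 2] makes [walk] a convex combination and absorbs the second order term in
    [energy_walk]. The [+ 2] keeps the inverse meaningful when there are no generators. *)
Definition step_size : R := (2 * N + 2)^-1.

Lemma step_size_gt0 : 0 < step_size.
Proof. by rewrite invr_gt0 ltr_wpDl ?mulr_ge0. Qed.

Lemma step_size_card : N * step_size <= 1 / 2.
Proof. by rewrite ler_pdivrMr ?ltr_wpDl ?mulr_ge0 //; lra. Qed.

Definition walk x := sip_sub x (sip_scale step_size (lap x)).

(** Expanding the quadratic form, the first order term lowers the energy by 4 theta |lap x|^2. The
    second order term is theta^2 times the energy of [lap x], which by [energy_le] gives back at
    most half of that. *)
Lemma energy_walk x :
  energy (walk x) <= energy x - 2 * step_size * ip (lap x) (lap x).
Proof.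
have t0 := step_size_gt0; have tN := step_size_card.
rewrite !energy_lap.
have -> : ip (lap (walk x)) (walk x) = ip (lap x) x
    - 2 * step_size * ip (lap x) (lap x)
    + step_size ^+ 2 * ip (lap (lap x)) (lap x).
  have lapw z : ip (lap (walk x)) z = ip x (lap z) - step_size * ip (lap x) (lap z).
    by rewrite lap_adj ipBl ipZl.
  rewrite [X in ip _ X]/walk ipBr ipZr !lapw -(lap_adj x (lap x)).
  by rewrite -(lap_adj (lap x) (lap x)) (ipC x (lap x)); ring.
have := energy_le (lap x); rewrite energy_lap.
have := ip_ge0 (lap x); move: tN t0.
move: (ip (lap x) (lap x)) (ip (lap (lap x)) (lap x)) (ip (lap x) x) N.
move: step_size => t a b c m tm t0 a0 h.
have h1 : t ^+ 2 * b <= t ^+ 2 * (2 * m * a) by rewrite ler_wpM2l ?sqr_ge0 //; lra.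
have h2 : t ^+ 2 * (2 * m * a) <= t * a.
  have -> : t ^+ 2 * (2 * m * a) = 2 * (m * t) * (t * a) by ring.
  by rewrite ler_piMl ?mulr_ge0 ?(ltW t0) //; lra.
lra.
Qed.

Lemma dist_walk x : dist x (walk x) <= Num.sqrt (energy x).
Proof.
have -> : dist x (walk x) = step_size * ipnorm (lap x).
  rewrite -[step_size in RHS]gtr0_norm ?step_size_gt0 // -ipnormZ.
  by apply: ipnorm_ext => z; rewrite !ipBl; ring.
have h : ipnorm (lap x) <= N * Num.sqrt (energy x).
  apply: le_trans (ipnorm_sum _ _) _.
  have -> : N * Num.sqrt (energy x) = \sum_(l : L) Num.sqrt (energy x).
    by rewrite sumr_const mulr_natl.
  apply: ler_sum => l _; rewrite -/(dist _ _) distC; exact: dist_op_energy.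
apply: (@le_trans _ _ (step_size * (N * Num.sqrt (energy x)))).
  by rewrite ler_wpM2l ?(ltW step_size_gt0).
rewrite mulrA (mulrC step_size) ler_piMl ?sqrtr_ge0 //.
by apply: le_trans step_size_card _; lra.
Qed.

Definition walkn j x := iter j walk x.

Section Decay.
Variables (kappa : R) (kappa_gt0 : 0 < kappa) (kappa_le1 : kappa <= 1).

Definition decay_rate : R := 1 - 2 * step_size * kappa.

Lemma decay_rate_bounds : 0 <= decay_rate < 1.
Proof.
have t0 := step_size_gt0.
have t1 : 2 * step_size <= 1.
  rewrite ler_pdivrMr ?ltr_wpDl ?mulr_ge0 //; have : 0 <= N by []; lra.
have : 2 * step_size * kappa <= 1 by rewrite mulr_ile1 ?mulr_ge0 ?(ltW t0) ?(ltW kappa_gt0).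
have : 0 < 2 * step_size * kappa by rewrite !mulr_gt0.
by rewrite /decay_rate; lra.
Qed.

Lemma walkn_decay x j :
  (forall i, (i < j)%N ->
     kappa * energy (walkn i x) <= ip (lap (walkn i x)) (lap (walkn i x))) ->
  energy (walkn j x) <= decay_rate ^+ j * energy x.
Proof.
elim: j => [|j IH] H; first by rewrite mul1r.
have /IH {}IH : forall i, (i < j)%N ->
    kappa * energy (walkn i x) <= ip (lap (walkn i x)) (lap (walkn i x)).
  by move=> i ij; apply: H; apply: ltnW.
have /andP[q0 _] := decay_rate_bounds.
rewrite exprS -mulrA; apply: le_trans (ler_wpM2l q0 IH).
apply: le_trans (energy_walk _) _; have := H j (ltnSn j).
move/(ler_wpM2l (ltW (mulr_gt0 (ltr0Sn R 1) step_size_gt0))).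
by rewrite /decay_rate; lra.
Qed.

Definition drift_bound : R := (1 - Num.sqrt decay_rate)^-1.

Lemma sqrt_decay_rate_lt1 : Num.sqrt decay_rate < 1.
Proof.
have /andP[q0 q1] := decay_rate_bounds.
by rewrite -[ltRHS]sqrtr1 ltr_sqrt.
Qed.

(** Each step has length at most the square root of the current energy, so the drift is bounded by a
    geometric series of ratio [Num.sqrt decay_rate]. *)
Lemma walkn_drift x j :
  (forall i, (i < j)%N ->
     kappa * energy (walkn i x) <= ip (lap (walkn i x)) (lap (walkn i x))) ->
  dist x (walkn j x) <= Num.sqrt (energy x) * drift_bound.
Proof.
move=> H; set r := Num.sqrt decay_rate.
have r1 : r < 1 := sqrt_decay_rate_lt1.
have r0 : 0 <= r by exact: sqrtr_ge0.
have /andP[q0 _] := decay_rate_bounds.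
apply: (@le_trans _ _ (Num.sqrt (energy x) * \sum_(i < j) r ^+ i)).
  elim: j H => [|j IH] H.
    by rewrite big_ord0 mulr0 /dist /ipnorm !(ipBl, ipBr) subrr sqrtr0.
  have Hj : forall i, (i < j)%N ->
      kappa * energy (walkn i x) <= ip (lap (walkn i x)) (lap (walkn i x)).
    by move=> i ij; apply: H; apply: ltnW.
  rewrite big_ord_recr mulrDr /=; apply: le_trans (dist_trans (walkn j x) _ _) _.
  apply: lerD; first exact: IH.
  apply: le_trans (dist_walk _) _.
  have -> : r ^+ j = Num.sqrt (decay_rate ^+ j).
    by elim: (j) => [|i IHi]; rewrite ?sqrtr1 // !exprS sqrtrM // IHi.
  by rewrite mulrC -sqrtrM ?exprn_ge0 // ler_wsqrtr // walkn_decay.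
rewrite ler_wpM2l ?sqrtr_ge0 // -[leRHS]mul1r ler_pdivlMr ?subr_gt0 //.
have -> : (\sum_(i < j) r ^+ i) * (1 - r) = 1 - r ^+ j.
  by rewrite mulrC -opprB mulNr -subrX1 opprB.
by rewrite gerBl exprn_ge0.
Qed.

(** Take the first time at which one of the two alternatives holds: the gap held before it, whence
    the drift bound. Such a time exists, as otherwise the energy would decay to 0 while staying
    above [tau]. *)
Lemma walkn_stop x (tau : R) : 0 < tau -> exists j,
  dist x (walkn j x) <= Num.sqrt (energy x) * drift_bound /\
  (energy (walkn j x) < tau \/
   ip (lap (walkn j x)) (lap (walkn j x)) < kappa * energy (walkn j x)).
Proof.
move=> tau0.
pose P j := (energy (walkn j x) < tau) ||
  (ip (lap (walkn j x)) (lap (walkn j x)) < kappa * energy (walkn j x)).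
have exP : exists j, P j.
  apply: contrapT => nP.
  have nPj j : tau <= energy (walkn j x) /\
      kappa * energy (walkn j x) <= ip (lap (walkn j x)) (lap (walkn j x)).
    split; rewrite leNgt; apply/negP => h; apply: nP; exists j.
      by rewrite /P h.
    by rewrite /P h orbT.
  have /andP[q0 q1] := decay_rate_bounds.
  have : decay_rate ^+ j * energy x @[j --> \oo] --> (0 : R).
    rewrite -[0](mul0r (energy x)); apply: cvgM; last exact: cvg_cst.
    by apply: cvg_expr; rewrite ger0_norm.
  move/cvgr_to_ge => /(_ tau) h; have : tau <= 0.
    apply: h; apply: nearW => j; apply: le_trans (nPj j).1 _.
    by apply: walkn_decay => i _; apply: (nPj i).2.
  by rewrite leNgt tau0.
exists (ex_minn exP); case: ex_minnP => j /orP Pj minj; split=> //.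
apply: walkn_drift => i ij; rewrite leNgt; apply/negP => h.
have : P i by rewrite /P h orbT.
by move=> /minj; rewrite leqNgt ij.
Qed.

End Decay.

(** The new letter lands to the right of [w], next to [x]; this is why relator bounds along the walk
    are stated for all [v]. *)
Lemma wact_walk w x z : ip (wact w (walk x)) z =
  (1 - N * step_size) * ip (wact w x) z +
  step_size * \sum_(l : L) ip (wact (w ++ [:: l]) x) z.
Proof.
rewrite wact_adj ipBl ipZl ip_lap sumrB sumr_const -!wact_adj -mulr_natl.
have -> : \sum_(l : L) ip (wr_op l x) (wact (winv w) z) =
    \sum_(l : L) ip (wact (w ++ [:: l]) x) z.
  by apply: eq_bigr => l _; rewrite -wact_adj wact_cat.
ring.
Qed.

(* [walk] is a convex combination of [1] and the letters, so that it preserves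
   uniform bounds on the defect of a relator [r] along the orbit. *)
Lemma walk_relator r (e : R) x :
  (forall v, dist (wact (r ++ v) x) (wact v x) <= e) ->
  forall v, dist (wact (r ++ v) (walk x)) (wact v (walk x)) <= e.
Proof.
move=> H v.
pose D (u : word n) := sip_sub (wact (r ++ u) x) (wact u x).
have t0 := step_size_gt0; have tN := step_size_card.
have -> : dist (wact (r ++ v) (walk x)) (wact v (walk x)) =
  ipnorm (sip_add (sip_scale (1 - N * step_size) (D v))
    (sip_scale step_size (sip_sum (index_enum _) (fun l => D (v ++ [:: l]))))).
  apply: ipnorm_ext => z; rewrite ipBl ipDl !ipZl !wact_walk ip_sum.
  have -> : \sum_(l : L) ip (D (v ++ [:: l])) z =
      \sum_(l : L) ip (wact ((r ++ v) ++ [:: l]) x) z -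
      \sum_(l : L) ip (wact (v ++ [:: l]) x) z.
    by rewrite -sumrB; apply: eq_bigr => l _; rewrite ipBl catA.
  by rewrite ipBl; ring.
have e0 : 0 <= e by apply: le_trans (H [::]); apply: dist_ge0.
have tN1 : 0 <= 1 - N * step_size by lra.
apply: le_trans (ipnormD _ _) _; rewrite !ipnormZ ger0_norm // gtr0_norm //.
have h1 : (1 - N * step_size) * ipnorm (D v) <= (1 - N * step_size) * e.
  by rewrite ler_wpM2l //; apply: H.
have h2 : step_size * ipnorm (sip_sum (index_enum _) (fun l => D (v ++ [:: l])))
    <= step_size * (N * e).
  rewrite ler_wpM2l ?(ltW t0) //; apply: le_trans (ipnorm_sum _ _) _.
  have -> : N * e = \sum_(l : L) e by rewrite sumr_const mulr_natl.
  by apply: ler_sum => l _; apply: H.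
by apply: le_trans (lerD h1 h2) _; rewrite le_eqVlt; apply/orP; left; apply/eqP; ring.
Qed.

Lemma walkn_relator r (e : R) x j :
  (forall v, dist (wact (r ++ v) x) (wact v x) <= e) ->
  forall v, dist (wact (r ++ v) (walkn j x)) (wact v (walkn j x)) <= e.
Proof. by move=> H; elim: j => //= j IH v; apply: walk_relator. Qed.

End Walk.

(* As long as the gap holds, the energy decays geometrically along the walk,
   which therefore stays close to [x m] but cannot reach a vector of energy below
   [(10 (|k m| + 1))^-2], since [k m] would almost fix such a vector. Hence the
   gap fails at some stage, for every large [m]. *)
Lemma spectral_gap_obstruction (R : realType) (n : nat) (G : groupType)
    (s : 'I_n -> G) (kappa : R) :
  0 < kappa ->
  (forall (X : nat -> word_rep R n) (xi : forall m, X m),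
    (forall m, 0 < energy (xi m)) ->
    (forall r v, word_val s r = 1%g ->
      (fun m => sqdist (wact (r ++ v) (xi m)) (wact v (xi m)) / energy (xi m))
        @ \oo --> (0 : R)) ->
    exists m, kappa * energy (xi m) < ip (lap (xi m)) (lap (xi m))) ->
  forall (X : nat -> word_rep R n) (x : forall m, X m) (k : nat -> word n),
  (fun m => energy (x m)) @ \oo --> (0 : R) ->
  (forall m, 1 <= dist (wact (k m) (x m)) (x m)) ->
  (forall r, word_val s r = 1%g -> exists M, forall m, (M <= m)%N -> forall v,
     dist (wact (r ++ v) (x m)) (wact v (x m)) <=
       (10 * (size (k m)).+1%:R)^-1 / m.+1%:R) ->
  False.
Proof.
move=> kappa0 gap X x k E0 kx rel.
(* Capping at 1 keeps [decay_rate] nonnegative. *)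
pose kap := Num.min kappa 1.
have kap0 : 0 < kap by rewrite lt_min kappa0 ltr01.
have kap1 : kap <= 1 by rewrite ge_min lexx orbT.
pose t m : R := (10 * (size (k m)).+1%:R)^-1.
have t0 m : 0 < t m by rewrite invr_gt0 mulr_gt0.
have tk m : (size (k m))%:R * t m <= 1 / 10.
  rewrite ler_pdivrMr ?mulr_gt0 // mulrA divfK ?pnatr_eq0 // mul1r.
  by rewrite ler_nat.
have /choice[j jP] m := walkn_stop kap0 kap1 (x m) (exprn_gt0 2 (t0 m)).
pose xi m := walkn (j m) (x m).
have K0 : 0 < @drift_bound R n kap.
  by rewrite invr_gt0 subr_gt0 sqrt_decay_rate_lt1.
have [M HM] : exists M, forall m, (M <= m)%N -> dist (x m) (xi m) <= 1 / 10.
  have d0 : 0 < (1 / 10 / @drift_bound R n kap) ^+ 2.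
    by rewrite exprn_gt0 // !divr_gt0.
  have /cvgn_epsP/(_ _ d0)[M HM] := E0; exists M => m /HM.
  rewrite subr0 ger0_norm ?energy_ge0 // => h; apply: le_trans (jP m).1 _.
  rewrite -ler_pdivlMr // -[leRHS]ger0_norm ?divr_ge0 ?(ltW K0) //.
  by rewrite -sqrtr_sqr ler_wsqrtr // ltW.
(* Otherwise [k m] would move [xi m] by at most 1/10, and therefore [x m], at distance at most 1/10
   from it, by at most 3/10. *)
have big m : (M <= m)%N -> t m ^+ 2 <= energy (xi m).
  move=> Mm; rewrite leNgt; apply/negP => small.
  have h1 : dist (wact (k m) (xi m)) (xi m) <= 1 / 10.
    apply: le_trans (dist_wact_energy _ _) _; apply: le_trans (tk m).
    rewrite ler_wpM2l // -[leRHS]ger0_norm ?(ltW (t0 m)) //.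
    by rewrite -sqrtr_sqr ler_wsqrtr // ltW.
  have h2 := HM m Mm; have h3 := kx m.
  have h4 := dist_trans (wact (k m) (xi m)) (wact (k m) (x m)) (x m).
  have h5 := dist_trans (xi m) (wact (k m) (xi m)) (x m).
  move: h4 h5; rewrite wact_dist (distC (xi m) (x m)).
  move: h1 h2 h3; move: (dist _ _) (dist _ _) (dist _ _) (dist _ _).
  by clear => a b c d; lra.
have [||m] := gap (fun m => X (M + m)%N) (fun m => xi (M + m)%N).
- by move=> m; apply: lt_le_trans (big _ (leq_addr _ _)); rewrite exprn_gt0.
- move=> r v /rel[M' HM']; apply/cvgn_epsP => e e0.
  have [N _ HN] := near_infty_natSinv_lt (PosNum e0).
  exists (maxn M' N) => m; rewrite geq_max => /andP[M'm Nm].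
  have Em := big _ (leq_addr m M).
  have Ep : 0 < energy (xi (M + m)%N) by apply: lt_le_trans Em; rewrite exprn_gt0.
  rewrite subr0 ger0_norm ?divr_ge0 ?sqr_ge0 ?(ltW Ep) // ltr_pdivrMr //.
  have mM : (M' <= M + m)%N by rewrite (leq_trans M'm) ?leq_addl.
  have h := walkn_relator (j (M + m)%N) (HM' _ mM) v.
  (* The energy is at least the square of [t], the very factor contained in the relator bound, so
     the quotient is at most (M + m + 1)^-2. *)
  apply: le_lt_trans (_ : (t (M + m)%N / (M + m).+1%:R) ^+ 2 < _).
    by rewrite sqdistE ler_pXn2r ?nnegrE ?dist_ge0 ?divr_ge0 ?(ltW (t0 _)).
  rewrite expr_div_n.
  have i1 : (M + m).+1%:R^-1 < e.
    by apply: HN; rewrite /= (leq_trans Nm) ?leq_addl.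
  have i0 : 0 < (M + m).+1%:R^-1 :> R by rewrite invr_gt0.
  have i2 : (M + m).+1%:R^-1 <= 1 :> R by rewrite invf_le1 ?ler1n.
  rewrite -exprVn mulrC; apply: (@lt_le_trans _ _ (e * t (M + m)%N ^+ 2)).
    rewrite ltr_pM2r ?exprn_gt0 // expr2; apply: le_lt_trans i1.
    by rewrite ler_piMl // ltW.
  by rewrite ler_wpM2l ?(ltW e0).
- have Em := big _ (leq_addr m M).
  (* The walk did not stop for lack of energy, so it stopped because the gap failed. *)
  have [|h] := (jP (M + m)%N).2; first by rewrite ltNge Em.
  move=> h'; have := lt_trans h' h; rewrite ltNge ler_wpM2r ?energy_ge0 //.
  by rewrite ge_min lexx.
Qed.

(** * Finitely presented covers and their approximations *)

Section PresentedGroup.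
Context {n : nat} (rels : seq (word n)).
Local Notation W := (seq ('I_n * bool)).

Lemma word_eqv_cat2 a b u v : word_eqv rels u v ->
  word_eqv rels (a ++ u ++ b) (a ++ v ++ b).
Proof.
elim=> {u v} [u|u v _|u v w _ IH1 _ IH2|u v i c|u r v rR].
- exact: word_eqv_refl.
- exact: word_eqv_sym.
- exact: word_eqv_trans IH1 IH2.
- have := word_eqv_cancel rels (a ++ u) (v ++ b) i c.
  by rewrite -!catA.
- by have := word_eqv_relator (a ++ u) (v ++ b) rR; rewrite -!catA.
Qed.

Lemma word_eqv_cat u u' v v' : word_eqv rels u u' -> word_eqv rels v v' ->
  word_eqv rels (u ++ v) (u' ++ v').
Proof.
move=> /(word_eqv_cat2 [::] v) uu' /(word_eqv_cat2 u' [::]).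
by rewrite !cats0; apply: word_eqv_trans.
Qed.

Lemma word_eqv_mulV (w : W) : word_eqv rels (w ++ winv w) [::].
Proof.
elim: w => [|[i b] w IH]; first exact: word_eqv_refl.
rewrite winv_cons; have := word_eqv_cat2 [:: (i, b)] [:: flip (i, b)] IH.
rewrite /= -catA => h; apply: word_eqv_trans h _.
exact: (word_eqv_cancel rels [::] [::] i b).
Qed.

Lemma word_eqv_mulVg (w : W) : word_eqv rels (winv w ++ w) [::].
Proof. by have := word_eqv_mulV (winv w); rewrite winvK. Qed.

Lemma word_eqv_of_quotient (u v : W) : word_eqv rels (u ++ winv v) [::] ->
  word_eqv rels u v.
Proof.
move=> h; have h1 := word_eqv_cat2 [::] v h.
have h2 := word_eqv_cat2 u [::] (word_eqv_sym (word_eqv_mulVg v)).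
move: h1 h2; rewrite !cats0 /= -!catA => h1 h2.
exact: word_eqv_trans h2 h1.
Qed.

Definition pres_rel : rel W := fun u v => `[< word_eqv rels u v >].

Fact pres_rel_equiv : equiv_class_of pres_rel.
Proof.
split=> [u|u v|v u w].
- by apply/asboolP; apply: word_eqv_refl.
- by apply/asboolP/asboolP => /word_eqv_sym.
- by move=> /asboolP uv /asboolP vw; apply/asboolP; apply: word_eqv_trans uv vw.
Qed.

Canonical pres_rel_canonical := EquivRelPack pres_rel_equiv.

Definition presented := {eq_quot pres_rel}%qT.
HB.instance Definition _ := Choice.on presented.
HB.instance Definition _ := EqQuotient.on presented.

Definition pclass (w : W) : presented := \pi_presented%qT w.

Lemma pclassP u v : pclass u = pclass v <-> word_eqv rels u v.
Proof.
split=> [/eqmodP /asboolP //|uv].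
by apply/eqmodP/asboolP.
Qed.

Lemma pclass_repr x : pclass (repr x) = x.
Proof. exact: reprK. Qed.

Lemma repr_pclass w : word_eqv rels (repr (pclass w)) w.
Proof. by apply/pclassP; rewrite pclass_repr. Qed.

Definition pmul (x y : presented) : presented := pclass (repr x ++ repr y).
Definition pinv (x : presented) : presented := pclass (winv (repr x)).

Lemma pmulE u v : pmul (pclass u) (pclass v) = pclass (u ++ v).
Proof. by apply/pclassP; apply: word_eqv_cat; apply: repr_pclass. Qed.

Fact pmulA : associative pmul.
Proof.
move=> x y z; rewrite -(pclass_repr x) -(pclass_repr y) -(pclass_repr z).
by rewrite !pmulE catA.
Qed.
Fact pmul1 : left_id (pclass [::]) pmul.
Proof. by move=> x; rewrite -(pclass_repr x) pmulE. Qed.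
Fact pmul1r : right_id (pclass [::]) pmul.
Proof. by move=> x; rewrite -(pclass_repr x) pmulE cats0. Qed.
Fact pmulV : left_inverse (pclass [::]) pinv pmul.
Proof.
move=> x; rewrite /pinv -{2}(pclass_repr x) pmulE.
by apply/pclassP/word_eqv_mulVg.
Qed.
Fact pmulVr : right_inverse (pclass [::]) pinv pmul.
Proof.
move=> x; rewrite /pinv -{1}(pclass_repr x) pmulE.
by apply/pclassP/word_eqv_mulV.
Qed.
HB.instance Definition _ := isGroup.Build presented pmulA pmul1 pmul1r pmulV pmulVr.

Definition presented_group : groupType := presented.

Lemma pclass_cat u v : (pclass (u ++ v) : presented_group) = (pclass u * pclass v)%g.
Proof. by rewrite -pmulE. Qed.

Lemma pclass_nil : (pclass [::] : presented_group) = 1%g.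
Proof. by []. Qed.

End PresentedGroup.

(** * The normalized Hilbert-Schmidt norm and words in unitary matrices *)

Section MatrixNorm.
Context {R : realType} {d : nat}.
Local Notation M := 'M[R[i]]_d.
Implicit Types A B U : M.

Lemma Re_scale (a : R) (z : R[i]) : complex.Re (a%:C * z) = a * complex.Re z.
Proof. by case: z => x y /=; rewrite mul0r subr0. Qed.

Lemma ReD (z w : R[i]) : complex.Re (z + w) = complex.Re z + complex.Re w.
Proof. by case: z w => [a b] [c e]. Qed.

Lemma Re_conj (z : R[i]) : complex.Re (Num.conj z) = complex.Re z.
Proof. by case: z. Qed.

Lemma conj_real (a : R) : Num.conj (a%:C : R[i]) = a%:C.
Proof. by rewrite -[LHS]/((a%:C)^*)%C /= oppr0. Qed.

Definition mx_ip A B : R := complex.Re (ntrace (A ^t* *m B)).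

Fact mx_ipDl A B D : mx_ip (A + B) D = mx_ip A D + mx_ip B D.
Proof.
by rewrite /mx_ip /ntrace linearD /= map_mxD mulmxDl linearD /= mulrDr ReD.
Qed.

Fact mx_ipZl (a : R) A B : mx_ip (a%:C *: A) B = a * mx_ip A B.
Proof.
rewrite /mx_ip /ntrace linearZ /= map_mxZ [X in X *: _]conj_real -scalemxAl linearZ /=.
by rewrite mulrCA Re_scale.
Qed.

Fact mx_ipC A B : mx_ip A B = mx_ip B A.
Proof.
rewrite /mx_ip /ntrace -Re_conj rmorphM; congr (complex.Re (_ * _)).
  by rewrite fmorphV rmorph_nat.
rewrite -trace_map_mx map_mxM -mxtrace_tr trmx_mul.
congr (\tr (_ *m _)); first by rewrite map_trmx.
by rewrite -map_mx_comp map_mx_id ?trmxK // => z; rewrite /= conjCK.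
Qed.

Fact mx_ip_ge0 A : 0 <= mx_ip A A.
Proof.
have : (0 : R[i]) <= ntrace (A ^t* *m A).
  rewrite /ntrace mulr_ge0 ?invr_ge0 //; apply: sumr_ge0 => i _.
  rewrite mxE; apply: sumr_ge0 => j _; rewrite !mxE mulrC.
  exact: mul_conjC_ge0.
by rewrite lecE => /andP[_].
Qed.

Definition mx_sip : semi_ip R := SemiIp (0 : M) mx_ipDl mx_ipZl mx_ipC mx_ip_ge0.

Lemma norm2E A : norm2 A = @ipnorm _ mx_sip A.
Proof. by []. Qed.

Lemma norm2_ge0 A : 0 <= norm2 A. Proof. exact: sqrtr_ge0. Qed.

Lemma norm2D A B : norm2 (A + B) <= norm2 A + norm2 B.
Proof. exact: (@ipnormD _ mx_sip). Qed.

Lemma norm2N A : norm2 (- A) = norm2 A.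
Proof.
have -> : - A = (sip_scale (-1) (A : mx_sip)) by rewrite /= rmorphN scaleN1r.
by rewrite !norm2E ipnormZ normrN normr1 mul1r.
Qed.

Lemma norm2_0 : norm2 (0 : M) = 0.
Proof.
by rewrite norm2E /ipnorm /= /mx_ip trmx0 map_mx0 mul0mx /ntrace linear0 mulr0 sqrtr0.
Qed.

Lemma norm2BC A B : norm2 (A - B) = norm2 (B - A).
Proof. by rewrite -norm2N opprB. Qed.

Lemma norm2B_trans B A D : norm2 (A - D) <= norm2 (A - B) + norm2 (B - D).
Proof. by apply: le_trans (norm2D _ _); rewrite addrA subrK. Qed.

Lemma unitarymx_mulV U : U \is unitarymx -> U *m U ^t* = 1%:M.
Proof. by move/unitarymxP. Qed.

Lemma unitarymx_Vmul U : U \is unitarymx -> U ^t* *m U = 1%:M.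
Proof. by move/unitarymxP => /mulmx1C. Qed.

Lemma trmxCK A : (A ^t*) ^t* = A.
Proof. by rewrite -map_trmx -map_mx_comp map_mx_id ?trmxK // => z; rewrite /= conjCK. Qed.

Lemma trmxC_mul A B : (A *m B) ^t* = B ^t* *m A ^t*.
Proof. by rewrite trmx_mul map_mxM. Qed.

Lemma unitarymx_trC U : U \is unitarymx -> U ^t* \is unitarymx.
Proof. by move=> UU; apply/unitarymxP; rewrite trmxCK unitarymx_Vmul. Qed.

Lemma norm2_unitaryl U A : U \is unitarymx -> norm2 (U *m A) = norm2 A.
Proof.
move=> UU; rewrite /norm2; congr (Num.sqrt (complex.Re (ntrace _))).
by rewrite trmxC_mul mulmxA -(mulmxA (A ^t*)) unitarymx_Vmul // mulmx1.
Qed.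

Lemma norm2_unitaryr U A : U \is unitarymx -> norm2 (A *m U) = norm2 A.
Proof.
move=> UU.
have E : \tr ((A *m U) ^t* *m (A *m U)) = \tr (A ^t* *m A).
  by rewrite trmxC_mul -mulmxA mxtrace_mulC -!mulmxA unitarymx_mulV // mulmx1.
by rewrite /norm2 /ntrace E.
Qed.

Lemma norm2_mul_trC_sub1 A U : U \is unitarymx ->
  norm2 (A *m U ^t* - 1%:M) = norm2 (A - U).
Proof.
move=> UU; rewrite -(norm2_unitaryr (A *m U ^t* - 1%:M) UU).
by rewrite mulmxBl mul1mx -mulmxA (unitarymx_Vmul UU) mulmx1.
Qed.

Lemma norm2_trC A : norm2 (A ^t*) = norm2 A.
Proof.
rewrite /norm2 /ntrace; congr (Num.sqrt (complex.Re (_ * _))).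
by rewrite trmxCK mxtrace_mulC.
Qed.

End MatrixNorm.

Section UnitaryWords.
Context {R : realType} {n d : nat} (U : 'I_n -> 'M[R[i]]_d).
Hypothesis U_unitary : forall i, U i \is unitarymx.

Definition letter_mx (l : 'I_n * bool) : 'M[R[i]]_d :=
  if l.2 then (U l.1) ^t* else U l.1.

Definition word_mx (w : word n) : 'M[R[i]]_d :=
  foldr (fun l A => letter_mx l *m A) 1%:M w.

Lemma letter_mx_unitary l : letter_mx l \is unitarymx.
Proof. by rewrite /letter_mx; case: ifP => // _; apply: unitarymx_trC. Qed.

Lemma letter_mx_flip l : letter_mx (flip l) = (letter_mx l) ^t*.
Proof. by case: l => i []; rewrite /letter_mx //= trmxCK. Qed.

Lemma word_mx_unitary w : word_mx w \is unitarymx.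
Proof.
elim: w => [|l w IH] /=.
  by apply/unitarymxP; rewrite trmx1 map_mx1 mulmx1.
by rewrite mul_unitarymx ?letter_mx_unitary.
Qed.

Lemma word_mx_cat u v : word_mx (u ++ v) = word_mx u *m word_mx v.
Proof. by elim: u => [|l u IH] /=; rewrite ?mul1mx // IH mulmxA. Qed.

Lemma word_mx_inv w : word_mx (winv w) = (word_mx w) ^t*.
Proof.
elim: w => [|l w IH]; first by rewrite /= trmx1 map_mx1.
by rewrite winv_cons word_mx_cat IH /= mulmx1 letter_mx_flip trmxC_mul.
Qed.

Lemma norm2_word_mx_quotient u v :
  norm2 (word_mx (u ++ winv v) - 1%:M) = norm2 (word_mx u - word_mx v).
Proof.
by rewrite word_mx_cat word_mx_inv norm2_mul_trC_sub1 ?word_mx_unitary.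
Qed.

Lemma norm2_word_mx_catl u v :
  norm2 (word_mx (u ++ v) - word_mx v) = norm2 (word_mx u - 1%:M).
Proof.
rewrite word_mx_cat -{2}[word_mx v]mul1mx -mulmxBl norm2_unitaryr //.
exact: word_mx_unitary.
Qed.

End UnitaryWords.

(** Only the values of [phi] on generators are kept: they define an exact representation of the free
    group, close to [phi] on the finitely many words of interest. *)
Lemma hyperlinear_presented (R : realType) (n : nat) (rels : seq (word n)) :
  hyperlinear R (presented_group rels) ->
  forall (tests : seq (word n)) (e : R), 0 < e ->
  (forall w, w \in tests -> ~ word_eqv rels w [::]) ->
  exists (d : nat) (U : 'I_n -> 'M[R[i]]_d), [/\ (0 < d)%N,
    forall i, U i \is unitarymx,
    forall r, r \in rels -> norm2 (word_mx U r - 1%:M) < e &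
    forall w, w \in tests -> Num.sqrt 2 - e < norm2 (word_mx U w - 1%:M)].
Proof.
move=> hyp tests e e0 testsP.
pose W := seq ('I_n * bool).
pose ws : seq W := rels ++ tests.
pose M : nat := (\sum_(w <- ws) size w)%N.
(* Each letter costs [3 * del], and the empty word and the replacement of [phi 1%g] by [1%:M] one
   [del] each; [M] bounds every length. *)
pose del : R := e / (3 * M + 3)%:R.
have del0 : 0 < del by rewrite divr_gt0 // ltr0n addn_gt0 orbT.
(* All suffixes, the empty one included, because [approx] compares a word with its tail. *)
pose S : seq W := [seq drop i w | w <- ws, i <- iota 0 (size w).+1].
pose F : seq (presented_group rels) := 1%g ::
  [seq pclass rels [:: l] | l <- enum {: 'I_n * bool}] ++
  [seq pclass rels u | u <- S].
have [d [phi [d0 phiU phiM phiS]]] := hyp del F del0.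
have F1 : 1%g \in F by rewrite inE eqxx.
have Fl l : pclass rels [:: l] \in F.
  rewrite inE mem_cat; apply/orP; right; apply/orP; left.
  by apply: map_f; rewrite mem_enum.
have FS u : u \in S -> pclass rels u \in F.
  by move=> uS; rewrite inE mem_cat (map_f _ uS) !orbT.
pose U i := phi (pclass rels [:: (i, false)]).
have UU i : U i \is unitarymx by apply: phiU.
(* The definition does not impose [phi 1%g = 1%:M]; cancelling one unitary factor in the defect at
   the pair (1, 1) gives it approximately. *)
have phi1 : norm2 (phi 1%g - 1%:M) < del.
  have := phiM 1%g 1%g F1 F1; rewrite mulg1 => /(_ F1).
  by rewrite -{3}[phi 1%g]mulmx1 -mulmxBr norm2_unitaryl // phiU.
(* An inverse letter is sent to an adjoint, not to a value of [phi]. The two are close since the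
   values at a generator and at its inverse multiply to nearly [phi 1%g]. *)
have phil l : norm2 (letter_mx U l - phi (pclass rels [:: l])) < 2 * del.
  case: l => i [] /=; last first.
    by rewrite /letter_mx /= subrr norm2_0 mulr_gt0.
  have V : (pclass rels [:: (i, false)] * pclass rels [:: (i, true)] = 1 :> presented_group rels)%g.
    rewrite -pclass_cat -pclass_nil; apply/pclassP.
    exact: (word_eqv_cancel rels [::] [::] i false).
  have := phiM _ _ (Fl (i, false)) (Fl (i, true)); rewrite V => /(_ F1) h.
  rewrite /letter_mx /= norm2BC -(@norm2_unitaryl _ _ (U i)) // mulmxBr.
  rewrite unitarymx_mulV //.
  apply: le_lt_trans (norm2B_trans (phi 1%g) _ _) _.
  have -> : 2 * del = del + del by rewrite mulr_natl mulr2n.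
  by apply: ltrD; [exact: h|exact: phi1].
have approx w : w \in S -> (forall i, drop i w \in S) ->
    norm2 (word_mx U w - phi (pclass rels w)) <= (3 * size w + 1)%:R * del.
  elim: w => [|l w IH] wS dS.
    by rewrite /= mul1r pclass_nil norm2BC ltW.
  have w1S : w \in S by have := dS 1; rewrite /= drop0.
  have {}IH := IH w1S (fun i => dS i.+1).
  have lw : (pclass rels (l :: w) = pclass rels [:: l] * pclass rels w :> presented_group rels)%g.
    by rewrite -pclass_cat.
  have h := phiM _ _ (Fl l) (FS _ w1S); rewrite -lw in h.
  have {}h := h (FS _ wS).
  rewrite [word_mx _ _]/=.
  apply: le_trans (norm2B_trans (letter_mx U l *m phi (pclass rels w)) _ _) _.
  rewrite -mulmxBr norm2_unitaryl ?letter_mx_unitary //.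
  have h2 : norm2 (letter_mx U l *m phi (pclass rels w) - phi (pclass rels (l :: w))) <= 3 * del.
    apply: le_trans (norm2B_trans (phi (pclass rels [:: l]) *m phi (pclass rels w)) _ _) _.
    rewrite -mulmxBl norm2_unitaryr; last by apply: phiU; apply: FS.
    move: h (phil l); move: (norm2 _) (norm2 _) => a b.
    by clear => h1 h2; lra.
  apply: le_trans (lerD IH h2) _.
  rewrite -mulrDl -natrD ler_wpM2r ?(ltW del0) // ler_nat /=.
  by clear; lia.
have sub w : w \in ws -> w \in S /\ forall i, drop i w \in S.
  move=> wws; suff H i : drop i w \in S by split=> //; rewrite -[w]drop0.
  have [iw|iw] := leqP i (size w).
    by apply/allpairsPdep; exists w, i; split=> //; rewrite mem_iota.
  rewrite drop_oversize ?(ltnW iw) // -(drop_size w).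
  by apply/allpairsPdep; exists w, (size w); split=> //; rewrite mem_iota /=.
have sz w : w \in ws -> (3 * size w + 1)%:R * del + del < e.
  move=> wws; rewrite -[X in _ + X]mul1r -mulrDl -(natrD _ _ 1) /del mulrA.
  rewrite ltr_pdivrMr ?ltr0n ?addn_gt0 ?orbT // mulrC ltr_pM2l // ltr_nat.
  have : (size w <= M)%N by rewrite /M (big_rem w wws) /= leq_addr.
  lia.
exists d, U; split=> // [r rr|w wt].
  have rws : r \in ws by rewrite mem_cat rr.
  have [rS dS] := sub _ rws; have := approx r rS dS.
  have -> : pclass rels r = 1%g :> presented_group rels.
    by apply/pclassP; have := word_eqv_relator [::] [::] rr; rewrite cats0.
  move=> h; apply: le_lt_trans (norm2B_trans (phi 1%g) _ _) _.
  by apply: lt_trans (sz _ rws); apply: ler_ltD.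
have wws : w \in ws by rewrite mem_cat wt orbT.
have [wS dS] := sub _ wws; have h := approx w wS dS.
have w1 : pclass rels w != 1%g :> presented_group rels.
  by apply/eqP => /pclassP; apply: testsP.
have := phiS _ (FS _ wS) w1; have := sz _ wws.
have := norm2B_trans (word_mx U w) (phi (pclass rels w)) 1%:M.
rewrite (norm2BC (phi (pclass rels w)) (word_mx U w)); move: h.
move: (norm2 _) (norm2 _) (norm2 _) (Num.sqrt 2) ((_)%:R * del).
by clear => a b c f g; lra.
Qed.

Lemma limn_einf_ge (R : realType) (u : nat -> R) (a : R) :
  (forall e : R, 0 < e -> exists N, forall n, (N <= n)%N -> a - e <= u n) ->
  (a%:E <= limn_einf (fun n => (u n)%:E))%E.
Proof.
move=> H; rewrite limn_einf_lim (cvg_lim _ (@cvg_einfs_sup R _)) //.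
apply/lee_addgt0Pr => e e0; have [N HN] := H e e0.
rewrite -leeBlDr // -EFinB.
apply: le_trans (ereal_sup_ubound _); last by exists N.
apply: le_ereal_inf_tmp => _ [p /= Np <-].
by rewrite lee_fin HN.
Qed.

(** * Matrices as operators on the Hilbert space of column vectors *)

Section ColumnHilbert.
Context {R : realType} {d : nat}.
Local Notation V := 'cV[R[i]]_d.
Implicit Types x y : V.

Definition cvdot x y : R[i] := \sum_i x i 0 * (y i 0)^*%C.

Fact cvdot_scalar y : scalar (cvdot^~ y).
Proof.
move=> a x z; rewrite /cvdot mulr_sumr -big_split; apply: eq_bigr => i _.
by rewrite !mxE mulrDl mulrA.
Qed.

Fact cvdot_herm x y : cvdot x y = ((cvdot y x)^*)%C.
Proof.
rewrite /cvdot -[conjc]/(@Num.conj R[i]) rmorph_sum; apply: eq_bigr => i _.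
by rewrite rmorphM /= conjCK mulrC.
Qed.

Fact cvdot_gt0 x : x != 0 -> 0 < cvdot x x.
Proof.
move=> x0; rewrite lt_def; apply/andP; split; last first.
  by apply: sumr_ge0 => i _; exact: mul_conjC_ge0.
apply: contra x0; rewrite psumr_eq0 => [/allP H|i _]; last exact: mul_conjC_ge0.
apply/eqP/colP => i; apply/eqP; rewrite mxE.
by have := H i (mem_index_enum _); rewrite /= mul_conjC_eq0.
Qed.

Definition cv_dot := dot_of cvdot_scalar cvdot_herm cvdot_gt0.

Lemma cv_dot_sqr x : complex.Re (cvdot x x) =
  \sum_i (complex.Re (x i 0) ^+ 2 + complex.Im (x i 0) ^+ 2).
Proof.
rewrite /cvdot (big_morph _ (@ReD R) (erefl : complex.Re 0 = 0)).
by apply: eq_bigr => i _; case: (x i 0) => a b /=; rewrite mulrN opprK !expr2.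
Qed.

Fact cv_dot_complete (u : nat -> V) :
  (forall e : R, 0 < e -> exists N : nat, forall m n : nat,
     (N <= m)%N -> (N <= n)%N -> dot_norm cv_dot (u m - u n) < e) ->
  exists l : V, (fun n => dot_norm cv_dot (u n - l)) @ \oo --> (0 : R).
Proof.
move=> uC.
have term_ge0 (z : R[i]) : 0 <= complex.Re z ^+ 2 + complex.Im z ^+ 2.
  by rewrite addr_ge0 ?sqr_ge0.
have normE x : dot_norm cv_dot x =
    Num.sqrt (\sum_i (complex.Re (x i 0) ^+ 2 + complex.Im (x i 0) ^+ 2)).
  by rewrite -cv_dot_sqr.
have bnd x i (a : R) : a ^+ 2 <= complex.Re (x i 0) ^+ 2 + complex.Im (x i 0) ^+ 2 ->
    `|a| <= dot_norm cv_dot x.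
  move=> h; rewrite normE -sqrtr_sqr ler_wsqrtr //; apply: le_trans h _.
  by rewrite (bigD1 i) //= lerDl sumr_ge0.
have /choice[re Hre] i : exists l : R, (fun n => complex.Re (u n i 0)) @ \oo --> l.
  apply: cauchyn_cvg => e /uC[N HN]; exists N => m n Nm Nn.
  apply: le_lt_trans (HN _ _ Nm Nn); apply: (bnd _ i).
  by rewrite !mxE; case: (u m i 0) (u n i 0) => [a b] [c k] /=; rewrite lerDl sqr_ge0.
have /choice[im Him] i : exists l : R, (fun n => complex.Im (u n i 0)) @ \oo --> l.
  apply: cauchyn_cvg => e /uC[N HN]; exists N => m n Nm Nn.
  apply: le_lt_trans (HN _ _ Nm Nn); apply: (bnd _ i).
  by rewrite !mxE; case: (u m i 0) (u n i 0) => [a b] [c k] /=; rewrite lerDr sqr_ge0.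
exists (\col_i (re i +i* im i)).
have -> : (fun n => dot_norm cv_dot (u n - \col_i (re i +i* im i))) =
    Num.sqrt \o (fun n => \sum_i ((complex.Re (u n i 0) - re i) ^+ 2
      + (complex.Im (u n i 0) - im i) ^+ 2)).
  apply/funext => n; rewrite normE /=; congr Num.sqrt; apply: eq_bigr => i _.
  by rewrite !mxE; case: (u n i 0).
rewrite -[X in _ --> X](sqrtr0 R); apply: continuous_cvg.
  exact: sqrt_continuous.
rewrite [X in _ --> X](_ : 0 = \sum_(i < d) 0); last by rewrite big1.
apply: cvgr_sum => i; rewrite -[X in _ --> X](addr0 0).
have sq0 (v : nat -> R) l : v @ \oo --> l -> (fun n => (v n - l) ^+ 2) @ \oo --> (0 : R).
  move=> vl; rewrite -[X in _ --> X](mul0r 0).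
  have h : (fun n => v n - l) @ \oo --> (0 : R).
    by rewrite -(subrr l); apply: cvgB => //; apply: cvg_cst.
  by under eq_fun do rewrite expr2; apply: cvgM.
by apply: cvgD; apply: sq0.
Qed.

Definition cv_hilbert : hilbert R := Hilbert cv_dot_complete.

Definition cv_basis (j : 'I_d) : cv_hilbert := (delta_mx j 0 : V).

Lemma cvdot_basisr x i : cvdot x (delta_mx i 0) = x i 0.
Proof.
have cn (b : bool) : ((b%:R : R[i])^*)%C = b%:R.
  by rewrite -[conjc]/(@Num.conj R[i]) rmorph_nat.
rewrite /cvdot (bigD1 i) //= mxE cn !eqxx mulr1 big1 ?addr0 // => j /negPf ji.
by rewrite mxE cn ji mulr0.
Qed.

Fact cv_basis_orthonormal i j : hdot cv_hilbert (cv_basis i) (cv_basis j) = (i == j)%:R.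
Proof.
by rewrite -[LHS]/(cvdot (cv_basis i) (cv_basis j)) cvdot_basisr !mxE eqxx andbT eq_sym.
Qed.

Fact cv_basis_span (x : cv_hilbert) :
  exists c : 'I_d -> R[i], x = \sum_i c i *: cv_basis i.
Proof.
exists (fun i => (x : V) i 0); apply/colP => k.
rewrite [RHS]summxE (bigD1 k) //= !mxE !eqxx mulr1 big1 ?addr0 // => i /negPf ik.
by rewrite !mxE eq_sym ik mulr0.
Qed.

Definition mx_op (A : 'M[R[i]]_d) : {linear cv_hilbert -> cv_hilbert} :=
  (mulmx A : {linear V -> V}).

Lemma cvdot_mulmx (A : 'M[R[i]]_d) x y : cvdot (A *m x) y = cvdot x (A ^t* *m y).
Proof.
rewrite /cvdot.
under eq_bigr do rewrite mxE mulr_suml.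
under [RHS]eq_bigr do rewrite mxE -[conjc]/(@Num.conj R[i]) rmorph_sum mulr_sumr.
rewrite exchange_big; apply: eq_bigr => i _; apply: eq_bigr => j _.
by rewrite !mxE rmorphM /= conjCK; ring.
Qed.

Lemma mx_op_unitary A : A \is unitarymx -> unitary_op (mx_op A).
Proof.
move=> AU; split=> [x y|y].
  rewrite -[LHS]/(cvdot (A *m (x : V)) (A *m (y : V))) cvdot_mulmx mulmxA.
  by rewrite unitarymx_Vmul // mul1mx.
exists (A ^t* *m (y : V)).
by rewrite -[LHS]/(A *m (A ^t* *m (y : V))) mulmxA unitarymx_mulV // mul1mx.
Qed.

Hypothesis d_gt0 : (0 < d)%N.

Definition cv_fdhilbert : fdhilbert R :=
  FDHilbert d_gt0 cv_basis_orthonormal cv_basis_span.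

Lemma op_mxE (A : 'M[R[i]]_d) (T : cv_fdhilbert -> cv_fdhilbert) :
  (forall x : V, T x = (A *m x : V)) -> op_mx T = A.
Proof.
move=> TE; apply/matrixP => i j; rewrite mxE TE.
rewrite -[LHS]/(cvdot (A *m delta_mx j 0) (delta_mx i 0)) cvdot_basisr.
rewrite mxE (bigD1 j) //= mxE !eqxx mulr1 big1 ?addr0 // => k /negPf kj.
by rewrite mxE kj mulr0.
Qed.

End ColumnHilbert.

(** * Almost invariant vectors in Hilbert-Schmidt operators *)

(* A family [S : 'I_d -> K] stands for the operator from [C^d] to [K] sending
   the i-th basis vector to [S i]; the form is the normalized Hilbert-Schmidt
   one and [hs_mulr S A] is the composition of [S] with [A]. *)
Section HilbertSchmidt.
Context {R : realType} (d : nat) (K : hilbert R).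
Local Notation HS := ('I_d -> K).
Implicit Types S T : HS.
Local Notation dotK := (hdot K).

Definition hs_ip S T : R :=
  d%:R^-1 * \sum_i complex.Re (dotK (S i) (T i)).

Fact hs_ipDl S S' T : hs_ip (fun i => S i + S' i) T = hs_ip S T + hs_ip S' T.
Proof.
rewrite /hs_ip -mulrDr -big_split; congr (_ * _); apply: eq_bigr => i _.
by rewrite linearDl ReD.
Qed.

Fact hs_ipZl (a : R) S T : hs_ip (fun i => a%:C *: S i) T = a * hs_ip S T.
Proof.
rewrite /hs_ip [RHS]mulrCA; congr (_ * _); rewrite mulr_sumr; apply: eq_bigr => i _.
by rewrite linearZl_LR Re_scale.
Qed.

Lemma Re_hdotC x y : complex.Re (dotK x y) = complex.Re (dotK y x).
Proof. by rewrite hermC expr0 mul1r Re_conj. Qed.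

Fact hs_ipC S T : hs_ip S T = hs_ip T S.
Proof. by rewrite /hs_ip; under eq_bigr do rewrite Re_hdotC. Qed.

Lemma Re_hdot_ge0 x : 0 <= complex.Re (dotK x x).
Proof.
have : 0 <= dotK x x by exact: dnorm_ge0.
by rewrite lecE => /andP[].
Qed.

Fact hs_ip_ge0 S : 0 <= hs_ip S S.
Proof. by rewrite mulr_ge0 ?invr_ge0 // sumr_ge0 // => i _; apply: Re_hdot_ge0. Qed.

Definition hs_sip : semi_ip R :=
  SemiIp ((fun=> 0) : HS) hs_ipDl hs_ipZl hs_ipC hs_ip_ge0.

Definition hs_mulr S (A : 'M[R[i]]_d) : HS := fun i => \sum_j A j i *: S j.

Lemma hs_mulrM S A B : hs_mulr (hs_mulr S A) B = hs_mulr S (A *m B).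
Proof.
apply/funext => i; rewrite /hs_mulr.
under eq_bigr do rewrite scaler_sumr.
rewrite exchange_big; apply: eq_bigr => k _; rewrite mxE scaler_suml.
by apply: eq_bigr => j _; rewrite scalerA mulrC.
Qed.

Lemma hs_mulr1 S : hs_mulr S 1%:M = S.
Proof.
apply/funext => i; rewrite /hs_mulr (bigD1 i) //= mxE eqxx scale1r big1 ?addr0 //.
by move=> j /negPf ji; rewrite mxE ji scale0r.
Qed.

Lemma hs_mulrB S A B : hs_mulr S (A - B) = fun i => hs_mulr S A i - hs_mulr S B i.
Proof.
apply/funext => i; rewrite /hs_mulr -sumrB; apply: eq_bigr => j _.
by rewrite !mxE scalerBl.
Qed.

Lemma hs_mulr_adj S T A : hs_ip (hs_mulr S A) T = hs_ip S (hs_mulr T (A ^t*)).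
Proof.
rewrite /hs_ip; congr (_ * _); rewrite /hs_mulr.
under eq_bigr do rewrite linear_sumlz (big_morph _ (@ReD R) (erefl : complex.Re 0 = 0)).
under [RHS]eq_bigr do rewrite linear_sumr (big_morph _ (@ReD R) (erefl : complex.Re 0 = 0)).
rewrite exchange_big; apply: eq_bigr => j _; apply: eq_bigr => i _.
by rewrite linearZl_LR linearZr_LR /= !mxE conjCK.
Qed.

Lemma Re_ntrace (A : 'M[R[i]]_d) :
  complex.Re (ntrace A) = d%:R^-1 * \sum_i complex.Re (A i i).
Proof.
have -> : ntrace A = (d%:R^-1 : R)%:C * \tr A.
  by rewrite /ntrace fmorphV rmorph_nat.
by rewrite Re_scale (big_morph _ (@ReD R) (erefl : complex.Re 0 = 0)).
Qed.

Lemma hs_ip_mulr S A : (forall i j, dotK (S i) (S j) = (i == j)%:R) ->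
  hs_ip S (hs_mulr S A) = complex.Re (ntrace A).
Proof.
move=> SO; rewrite Re_ntrace /hs_ip; congr (_ * _); apply: eq_bigr => i _.
rewrite /hs_mulr linear_sumr (bigD1 i) //= linearZr_LR /= SO eqxx mulr1 big1.
  by rewrite addr0 Re_conj.
by move=> j /negPf ji; rewrite linearZr_LR /= SO eq_sym ji mulr0.
Qed.

Lemma hs_norm_mulr S A : (forall i j, dotK (S i) (S j) = (i == j)%:R) ->
  @ipnorm _ hs_sip (hs_mulr S A) = norm2 A.
Proof.
move=> SO; rewrite /norm2 /ipnorm; congr Num.sqrt.
rewrite [LHS]/= hs_mulr_adj hs_mulrM hs_ip_mulr // /ntrace.
by rewrite mxtrace_mulC.
Qed.

End HilbertSchmidt.

Section HilbertSchmidtRep.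
Context {R : realType} {d n : nat} (K : hilbert R) (G : groupType).
Context (s : 'I_n -> G) (U : 'I_n -> 'M[R[i]]_d).
Hypothesis U_unitary : forall i, U i \is unitarymx.
Context (pi : G -> {linear K -> K}) (pi_rep : unitary_rep pi).
Local Notation HS := (hs_sip d K).

Lemma rep1 x : pi 1%g x = x.
Proof.
have [_ /(_ x)[y <-]] := pi_rep.1 1%g.
by rewrite -pi_rep.2 mulg1.
Qed.

Lemma repV g x : pi g^-1%g (pi g x) = x.
Proof. by rewrite -pi_rep.2 mulVg rep1. Qed.

Lemma rep_adj g x y : hdot K (pi g x) y = hdot K x (pi g^-1%g y).
Proof. by rewrite -((pi_rep.1 g^-1%g).1 (pi g x)) repV. Qed.

Definition hs_act g (A : 'M[R[i]]_d) (S : HS) : HS :=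
  fun i => pi g (hs_mulr S (A ^t*) i).

Lemma hs_actM g h A B S : hs_act g A (hs_act h B S) = hs_act (g * h)%g (A *m B) S.
Proof.
apply/funext => i; rewrite /hs_act pi_rep.2 trmxC_mul -hs_mulrM; congr (pi g _).
rewrite {1}/hs_mulr [in RHS]/hs_mulr linear_sum; apply: eq_bigr => j _.
by rewrite linearZ.
Qed.

Lemma hs_act1 S : hs_act 1%g 1%:M S = S.
Proof.
by apply/funext => i; rewrite /hs_act rep1 trmx1 map_mx1 hs_mulr1.
Qed.

Lemma hs_act_adj g A S T : ip (hs_act g A S) T = ip S (hs_act g^-1%g (A ^t*) T).
Proof.
transitivity (hs_ip (hs_mulr S (A ^t*)) (fun i => pi g^-1%g (T i))).
  by rewrite /= /hs_ip; congr (_ * _); apply: eq_bigr => i _; rewrite rep_adj.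
rewrite hs_mulr_adj /=; congr hs_ip; apply/funext => i; rewrite /hs_act.
by rewrite /hs_mulr linear_sum; apply: eq_bigr => j _; rewrite linearZ.
Qed.

Definition hs_op (l : 'I_n * bool) : HS -> HS :=
  hs_act (letter_val s l) (letter_mx U l).

Fact hs_op_adj l S T : ip (hs_op l S) T = ip S (hs_op (flip l) T).
Proof. by rewrite hs_act_adj /hs_op letter_val_flip letter_mx_flip. Qed.

Fact hs_op_iso l S T : ip (hs_op l S) (hs_op l T) = ip S T.
Proof.
rewrite hs_op_adj /hs_op hs_actM letter_val_flip mulVg letter_mx_flip.
by rewrite unitarymx_Vmul ?letter_mx_unitary // hs_act1.
Qed.

Definition hs_rep : word_rep R n := WordRep hs_op_adj hs_op_iso.

Lemma hs_wact w (S : hs_rep) : wact w S = hs_act (word_val s w) (word_mx U w) S.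
Proof.
elim: w => [|l w IH]; first by rewrite /= word_val_nil hs_act1.
by rewrite /= IH /hs_op hs_actM word_val_cons.
Qed.

(** The common unitary [pi (word_val s v)] factors out and an orthonormal [S] is an isometry, so
    only the matrices remain. This bounds the defect of relators and also shows that [k m] moves the
    vector. *)
Lemma hs_wact_dist (S : hs_rep) u v : word_val s u = word_val s v ->
  (forall i j, hdot K (S i) (S j) = (i == j)%:R) ->
  dist (wact u S) (wact v S) = norm2 (word_mx U u - word_mx U v).
Proof.
move=> uv SO; rewrite !hs_wact uv -norm2_trC linearB /= map_mxB.
rewrite -(hs_norm_mulr _ SO) hs_mulrB /dist.
have -> : sip_sub (hs_act (word_val s v) (word_mx U u) S : HS)
    (hs_act (word_val s v) (word_mx U v) S) = fun i =>
  pi (word_val s v) (hs_mulr S ((word_mx U u) ^t*) i - hs_mulr S ((word_mx U v) ^t*) i).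
  apply/funext => i.
  by rewrite /sip_sub /= /hs_act linearB /= rmorphN scaleN1r.
rewrite /ipnorm /= /hs_ip; congr (Num.sqrt (_ * _)); apply: eq_bigr => i _.
congr complex.Re; exact: (pi_rep.1 _).1.
Qed.

(** For unit vectors the left side is 2 - 2 Re <A, B> = 2 Re <A, A - B>, with [B] the compression of
    [pi g], and [A] has norm 1. The bound is linear in [norm2 (A - B)], hence a square root for
    distances. *)
Lemma hs_act_isometry g (A B : 'M[R[i]]_d) (S : HS) : A \is unitarymx ->
  (forall i j, hdot K (S i) (S j) = (i == j)%:R) ->
  (forall i j, B i j = hdot K (pi g (S j)) (S i)) -> (0 < d)%N ->
  sqdist (hs_act g A S) S <= 2 * norm2 (A - B).
Proof.
have fin (a b : R) : 1 - b <= a -> 1 - b *+ 2 + 1 <= 2 * a by lra.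
move=> AU SO BE d0.
have tr1 : complex.Re (ntrace (1%:M : 'M[R[i]]_d)) = 1.
  by rewrite /ntrace mxtrace1 mulVf // pnatr_eq0 -lt0n.
have S1 : ip S S = 1 by rewrite -{2}[S]hs_mulr1 [LHS]hs_ip_mulr.
have A1 : ip (hs_act g A S) (hs_act g A S) = 1.
  by rewrite hs_act_adj hs_actM mulVg unitarymx_Vmul // hs_act1.
have AB : ip (hs_act g A S) S = mx_ip A B.
  have -> : ip (hs_act g A S) S =
      hs_ip (hs_mulr (fun i => pi g (S i)) (A ^t*)) S.
    congr hs_ip; apply/funext => i; rewrite /hs_act /hs_mulr linear_sum.
    by apply: eq_bigr => j _; rewrite linearZ.
  rewrite hs_mulr_adj trmxCK /mx_ip Re_ntrace /hs_ip; congr (_ * _).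
  apply: eq_bigr => i _; congr complex.Re.
  rewrite /hs_mulr linear_sumr mxE; apply: eq_bigr => k _.
  by rewrite linearZr_LR /= !mxE BE.
have AA : mx_ip A A = 1 by rewrite /mx_ip unitarymx_Vmul.
rewrite sqdist_ip S1 A1 AB.
have := @ip_le_norm _ (@mx_sip R d) A (A - B).
rewrite -!norm2E.
have -> : norm2 A = 1 by rewrite /norm2 -/(mx_ip A A) AA sqrtr1.
have -> : @ip _ (@mx_sip R d) A (A - B) = 1 - mx_ip A B.
  have -> : A - B = sip_sub (A : @mx_sip R d) B.
    by rewrite /sip_sub /= rmorphN scaleN1r.
  by rewrite ipBr -AA.
by rewrite mul1r; apply: fin.
Qed.

End HilbertSchmidtRep.

Section EnumWords.
Context {n : nat}.
Local Notation W := (seq ('I_n * bool)).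

(** A finite exhaustion of the countable set of words, by their codes. *)
Definition words_below (m : nat) : seq W := pmap (@unpickle W) (iota 0 m).

Lemma mem_words_below (w : W) m : (pickle w < m)%N -> w \in words_below m.
Proof.
move=> wm; rewrite mem_pmap; apply/mapP; exists (pickle w).
  by rewrite mem_iota.
by rewrite pickleK.
Qed.

End EnumWords.

Lemma not_finitely_presentable_word (G : groupType) (n : nat) (s : 'I_n -> G)
    (rels : seq (word n)) :
  ~ finitely_presentable G -> (forall g, exists w, word_val s w = g) ->
  (forall r, r \in rels -> word_val s r = 1%g) ->
  exists k : word n, word_val s k = 1%g /\ ~ word_eqv rels k [::].
Proof.
move=> infpres s_gen rels1; apply: contrapT => nok; apply: infpres.
exists n, s, rels; split=> // u v; split; last exact: word_val_eqv.
move=> uv; apply: contrapT => nuv; apply: nok; exists (u ++ winv v).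
split; first by rewrite word_val_cat word_val_inv uv mulgV.
by move=> /word_eqv_of_quotient.
Qed.

Lemma orthogonal_projection_adj (R : realType) (H K : hilbert R)
    (J : {linear H -> K}) (P : {linear K -> H}) :
  isometric_embedding J -> orthogonal_projection J P ->
  forall (y : K) (x : H), hdot H (P y) x = hdot K y (J x).
Proof.
move=> Jiso Port y x; have := Port y x; rewrite linearBl /= Jiso.
by move/eqP; rewrite subr_eq0 => /eqP.
Qed.

(** * The hyperlinear approximation and its almost invariant vectors *)

Section Approximation.
Context {R : realType} {G : groupType} {n : nat} (s : 'I_n -> G).
Hypothesis s_gen : forall g, exists w, word_val s w = g.
Context (d : nat -> nat) (U : forall m, 'I_n -> 'M[R[i]]_(d m)) (err : nat -> R).
Hypothesis d_gt0 : forall m, (0 < d m)%N.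
Hypothesis U_unitary : forall m i, U m i \is unitarymx.
Hypothesis err_cvg0 : err @ \oo --> (0 : R).
Hypothesis U_rel : forall r, word_val s r = 1%g ->
  exists M, forall m, (M <= m)%N -> norm2 (word_mx (U m) r - 1%:M) < err m.
Hypothesis U_nontriv : forall w, word_val s w != 1%g ->
  exists M, forall m, (M <= m)%N ->
    Num.sqrt 2 - err m < norm2 (word_mx (U m) w - 1%:M).

(** The matrices are indexed by words; choosing one word for each element turns them into maps on
    [G]. These are multiplicative up to words of trivial value, whose matrices tend to the
    identity. *)
Definition lift g : word n := projT1 (cid (s_gen g)).

Lemma liftK g : word_val s (lift g) = g.
Proof. exact: projT2 (cid (s_gen g)). Qed.

Definition approx_space m : fdhilbert R := @cv_fdhilbert R (d m) (d_gt0 m).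

Definition approx_op m g : {linear approx_space m -> approx_space m} :=
  mx_op (word_mx (U m) (lift g)).

Lemma word_mx_eq_val u v : word_val s u = word_val s v -> exists M, forall m,
  (M <= m)%N -> norm2 (word_mx (U m) u - word_mx (U m) v) < err m.
Proof.
move=> uv; have [|M HM] := @U_rel (u ++ winv v).
  by rewrite word_val_cat word_val_inv uv mulgV.
by exists M => m /HM; rewrite norm2_word_mx_quotient //.
Qed.

Lemma approx_op_hyperlinear : hyperlinear_approximation approx_op.
Proof.
split=> [m g|g h|g g1].
- by apply: mx_op_unitary; apply: word_mx_unitary.
- have [|M HM] := @word_mx_eq_val (lift g ++ lift h) (lift (g * h)%g).
    by rewrite word_val_cat !liftK.
  apply: (squeeze_cvgr _ (cvg_cst 0) err_cvg0); exists M => // m /= /HM.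
  rewrite /op_norm2 (op_mxE (A := word_mx (U m) (lift g ++ lift h) -
    word_mx (U m) (lift (g * h)%g))) => [h1|x]; first by rewrite norm2_ge0 ltW.
  by rewrite word_mx_cat mulmxBl -mulmxA.
- have fin (a b c e : R) : b - c < a -> c < e -> b - e <= a by lra.
  apply: limn_einf_ge => e e0.
  have [|M HM] := @U_nontriv (lift g); first by rewrite liftK.
  have /cvgn_epsP/(_ e e0)[N HN] := err_cvg0.
  exists (maxn M N) => m; rewrite geq_max => /andP[/HM h1 /HN h2].
  rewrite /op_norm2 (op_mxE (A := word_mx (U m) (lift g) - 1%:M)) => [|x].
    move: h1 h2; rewrite subr0 ltr_norml => + /andP[_].
    exact: fin.
  by rewrite mulmxBl mul1mx.
Qed.

Context (K : nat -> hilbert R) (J : forall m, {linear approx_space m -> K m})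
  (P : forall m, {linear K m -> approx_space m})
  (pi : forall m, G -> {linear K m -> K m}).
Hypothesis J_iso : forall m, isometric_embedding (J m).
Hypothesis P_proj : forall m, orthogonal_projection (J m) (P m).
Hypothesis pi_rep : forall m, unitary_rep (pi m).
Hypothesis pi_cvg : forall g, (fun m => op_norm2
  (fun x : approx_space m => approx_op m g x - P m (pi m g (J m x))))
    @ \oo --> (0 : R).

Definition approx_rep m : word_rep R n := hs_rep s (@U_unitary m) (pi_rep m).

Definition approx_vec m : approx_rep m := fun i => J m (@cv_basis R (d m) i).

Arguments approx_vec : clear implicits.

Lemma approx_vec_orthonormal m i j :
  hdot (K m) (approx_vec m i) (approx_vec m j) = (i == j)%:R.
Proof. by rewrite J_iso; apply: cv_basis_orthonormal. Qed.

Lemma approx_vec_wact m u v : word_val s u = word_val s v ->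
  dist (wact u (approx_vec m)) (wact v (approx_vec m)) =
  norm2 (word_mx (U m) u - word_mx (U m) v).
Proof. by move=> uv; apply: hs_wact_dist => //; apply: approx_vec_orthonormal. Qed.

(** [w] and the chosen word of its value act almost alike, up to [err]; for the chosen word,
    stability and [hs_act_isometry] apply. *)
Lemma approx_vec_almost_inv w :
  (fun m => dist (wact w (approx_vec m)) (approx_vec m)) @ \oo --> (0 : R).
Proof.
set g := word_val s w.
pose a m := op_norm2
  (fun x : approx_space m => approx_op m g x - P m (pi m g (J m x))).
have h1 m : dist (wact (lift g) (approx_vec m)) (approx_vec m) <=
    Num.sqrt (2 * a m).
  rewrite -[leLHS]ger0_norm ?dist_ge0 // -sqrtr_sqr ler_wsqrtr //.
  rewrite -sqdistE hs_wact liftK.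
  pose B : 'M[R[i]]_(d m) :=
    op_mx (fun x : approx_space m => P m (pi m g (J m x))).
  have aE : a m = norm2 (word_mx (U m) (lift g) - B).
    rewrite /a /op_norm2; congr norm2; apply/matrixP => i j.
    rewrite !mxE linearBl; congr (_ - _).
    have := @op_mxE _ _ (d_gt0 m) (word_mx (U m) (lift g)) (approx_op m g) (fun x => erefl).
    by move/matrixP => /(_ i j); rewrite mxE.
  rewrite aE; apply: (hs_act_isometry (@pi_rep m)); last exact: d_gt0.
  - exact: word_mx_unitary (@U_unitary m) _.
  - exact: approx_vec_orthonormal.
  - move=> i j; rewrite mxE.
    exact: (orthogonal_projection_adj (@J_iso m) (@P_proj m)).
have [|M HM] := @word_mx_eq_val w (lift g); first by rewrite liftK.
have lim0 : (fun m => err m + Num.sqrt (2 * a m)) @ \oo --> (0 : R).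
  rewrite -[X in _ --> X](addr0 0); apply: cvgD => //.
  rewrite -[X in _ --> X](sqrtr0 R); apply: continuous_cvg.
    exact: sqrt_continuous.
  rewrite -[X in _ --> X](mulr0 2); apply: cvgM; first exact: cvg_cst.
  exact: pi_cvg.
apply: (squeeze_cvgr _ (cvg_cst 0) lim0); exists M => // m /= /HM h2.
rewrite dist_ge0 /=.
apply: le_trans (dist_trans (wact (lift g) (approx_vec m)) _ _) _.
apply: lerD; last exact: h1.
by rewrite approx_vec_wact ?liftK // ltW.
Qed.

Lemma approx_vec_energy : (fun m => energy (approx_vec m)) @ \oo --> (0 : R).
Proof.
rewrite [X in _ --> X](_ : 0 = \sum_(l : 'I_n * bool) 0); last by rewrite big1.
apply: cvgr_sum => l; rewrite -[X in _ --> X](mul0r 0).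
under eq_fun do rewrite sqdistE expr2.
by apply: cvgM; apply: (approx_vec_almost_inv [:: l]).
Qed.

End Approximation.

Arguments approx_vec {R G n} s {d U d_gt0} U_unitary {K} J { pi } pi_rep m.

Theorem theorem1p10 (R : realType) (Gamma : groupType)
  (Gamma_countable : countable [set: Gamma]%classic)
  (Gamma_T : property_T R Gamma)
  (Gamma_infpres : ~ finitely_presentable Gamma)
  (Gamma_stable : weakly_ucp_stable R Gamma) :
  exists G : groupType, ~ hyperlinear R G.
Proof.
apply: contrapT => nohyp.
have hyp (G : groupType) : hyperlinear R G.
  by apply: contrapT => h; apply: nohyp; exists G.
have [n [s [C [C0 s_gen TC]]]] := property_T_generators Gamma_T.
have [kappa [kappa0 gap]] := spectral_gap s_gen C0 TC.
pose rels m : seq (word n) := [seq w <- words_below m | word_val s w == 1%g].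
have rels1 m r : r \in rels m -> word_val s r = 1%g.
  by rewrite mem_filter => /andP[/eqP].
have /choice[k kP] m := not_finitely_presentable_word Gamma_infpres s_gen (@rels1 m).
(* The first factor matches the energy threshold in [spectral_gap_obstruction], and the second makes
   the defect vanish relative to it. *)
pose err m : R := (10 * (size (k m)).+1%:R)^-1 / m.+1%:R.
have err0 m : 0 < err m by rewrite !divr_gt0 // invr_gt0 mulr_gt0.
(* [k m] is trivial in [Gamma] but not in the cover. The other words are nontrivial in [Gamma],
   hence in the cover, and provide the lower limit required of a hyperlinear approximation. *)
pose tests m : seq (word n) :=
  k m :: [seq w <- words_below m | word_val s w != 1%g].
have testsP m w : w \in tests m -> ~ word_eqv (rels m) w [::].
  rewrite inE => /orP[/eqP ->|]; first exact: (kP m).2.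
  rewrite mem_filter => /andP[w1 _] /(word_val_eqv (@rels1 m)).
  by rewrite word_val_nil => /eqP; apply/negP.
pose data := {d : nat & 'I_n -> 'M[R[i]]_d}.
have /choice[f fP] m : exists f : data, [/\ (0 < projT1 f)%N,
    forall i, projT2 f i \is unitarymx,
    forall r, r \in rels m -> norm2 (word_mx (projT2 f) r - 1%:M) < err m &
    forall w, w \in tests m ->
      Num.sqrt 2 - err m < norm2 (word_mx (projT2 f) w - 1%:M)].
  have [d [U UP]] := hyperlinear_presented (hyp _) (err0 m) (@testsP m).
  by exists (existT _ d U).
pose d m := projT1 (f m); pose U m : 'I_n -> 'M[R[i]]_(d m) := projT2 (f m).
have d0 m : (0 < d m)%N by case: (fP m).
have UU m i : U m i \is unitarymx by have [_ + _ _] := fP m; apply.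
have err_le m : err m <= m.+1%:R^-1.
  rewrite /err ler_piMl ?invr_ge0 // invf_le1 ?mulr_gt0 //.
  by rewrite -natrM ler1n muln_gt0.
have errcvg : err @ \oo --> (0 : R).
  apply: (squeeze_cvgr _ (cvg_cst 0) (@cvg_harmonic R)).
  by apply: nearW => m; rewrite (ltW (err0 m)) err_le.
have Urel r : word_val s r = 1%g -> exists M, forall m, (M <= m)%N ->
    norm2 (word_mx (U m) r - 1%:M) < err m.
  move=> r1; exists (pickle (r : seq ('I_n * bool))).+1 => m rm.
  have [_ _ + _] := fP m; apply; rewrite mem_filter r1 eqxx.
  exact: mem_words_below.
have Unontriv w : word_val s w != 1%g -> exists M, forall m, (M <= m)%N ->
    Num.sqrt 2 - err m < norm2 (word_mx (U m) w - 1%:M).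
  move=> w1; exists (pickle (w : seq ('I_n * bool))).+1 => m wm.
  have [_ _ _] := fP m; apply; rewrite inE mem_filter w1 /=.
  by rewrite mem_words_below ?orbT.
have [K [J [P [pi [Jiso Pproj pirep picvg]]]]] :=
  Gamma_stable _ _ (approx_op_hyperlinear s_gen d0 UU errcvg Urel Unontriv).
pose X m := approx_rep s UU pirep m.
pose x m : X m := approx_vec s UU J pirep m.
apply: (spectral_gap_obstruction kappa0 gap (X := X) (x := x) (k := k)).
- exact: (approx_vec_energy UU errcvg Urel Jiso Pproj pirep picvg).
- move=> m; have -> : dist (wact (k m) (x m)) (x m) =
      dist (wact (k m) (x m)) (wact [::] (x m)) by [].
  rewrite approx_vec_wact //; last by rewrite word_val_nil (kP m).1.
  have [_ _ _ /(_ (k m))] := fP m; rewrite inE eqxx => /(_ isT) h.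
  apply: ltW; apply: le_lt_trans h.
  (* As [err m <= 1 / 10], this leaves a displacement of at least 1. *)
  have sqrt2 : 11 / 10 <= Num.sqrt 2 :> R.
    rewrite -[leLHS]ger0_norm ?divr_ge0 // -sqrtr_sqr ler_wsqrtr //.
    by rewrite expr2; lra.
  have : err m <= 1 / 10.
    apply: (@le_trans _ _ (10 * (size (k m)).+1%:R)^-1).
      by rewrite ler_piMr ?invr_ge0 ?mulr_ge0 // invf_le1 ?ler1n.
    by rewrite div1r lef_pV2 ?posrE ?mulr_gt0 // ler_peMr // ler1n.
  move: sqrt2; move: (Num.sqrt 2) (err m) => a b; lra.
- move=> r r1; have [M HM] := Urel r r1; exists M => m Mm v.
  rewrite approx_vec_wact //; last by rewrite word_val_cat r1 mul1g.
  by rewrite norm2_word_mx_catl //; apply: ltW (HM m Mm).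
Qed.
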